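(* The quantum groups $D_4$, $D_4^+$, $H_4^+$ satisfy $$D_4\subsetneq D_4^+\subsetneq H_4^+ .$$ Moreover, the subgroup $D_4$ is obtained from $D_4^+$ by imposing commutativity on the entries of the fundamental representation, and it is likewise obtained from $D_4^+$ by imposing $(-1)$-commutativity on the entries of the fundamental representation.
   Context: **Compact matrix quantum groups.** A compact matrix quantum group is a pair $G=(A,u)$, $A=:O(G)$ a $*$-algebra and $u=(u_{ij})\in M_N(A)$ (the fundamental representation), such that the $u_{ij}$ generate $A$, the matrices $u$ and $u^t$ are similar to unitary matrices, and $\Delta(u_{ij}):=\sum_k u_{ik}\otimes u_{kj}$ extends to a $*$-homomorphism $A\to A\otimes A$. A matrix group $G\subset M_N(\mathbb C)$ is viewed as the pair consisting of the algebra generated by the coordinate functions $u_{ij}(g)=g_{ij}$ and the matrix $u$. We write $H\subset G$ (quantum subgroup) for $H=(O(H),v)$, $G=(O(G),u)$ with $u,v$ of the same size if there is a surjective $*$-homomorphism $O(G)\to O(H)$ with $u_{ij}\mapsto v_{ij}$; $G,H$ are identical if $G\subset H$ and $H\subset G$; $H\subsetneq G$ means $H\subset G$ and $H,G$ not identical. $O(O_N^+)$ is the universal $*$-algebra generated by $u_{ij}$, $1\le i,j\le N$, with $u_{ij}=u_{ij}^*$, $uu^t=u^tu=1$. For $G\subset O_N^+$, $\mathrm{Mor}(u^{\otimes k},u^{\otimes l})=\{T:(\mathbb C^N)^{\otimes k}\to(\mathbb C^N)^{\otimes l}\mid Tu^{\otimes k}=u^{\otimes l}T\}$. ''Imposing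 relations'' means passing to the quotient of $O(G)$ by these relations. $u$ has $(-1)$-commutative entries if for all $i\ne j$, $k\neq l$: $u_{ik}u_{jk}=-u_{jk}u_{ik}$, $u_{ki}u_{kj}=-u_{kj}u_{ki}$, $u_{ik}u_{jl}=u_{jl}u_{ik}$. **Partitions.** $P(k,l)$ is the set of partitions (into nonempty blocks) of $k$ upper points and $l$ lower points, drawn in two rows. $P_{N\text{-lin}}(k,l)$ is the complex vector space with basis $P(k,l)$. Operations, extended (anti)linearly: tensor product $p\otimes q$ (side by side); composition $qp$ for $p\in P(k,l)$, $q\in P(l,m)$ (put $q$ below $p$, identify the middle points, each connected component not connected to upper or lower points is removed and gives a factor $N$); involution $p^*$ (reflection exchanging upper and lower row, antilinear). A linear category of partitions is a collection of subspaces $K(k,l)\subset P_{N\text{-lin}}(k,l)$ closed under these operations and containing the identity partition $\mathrm{id}\in P(1,1)$ (one block) and the pair partition in $P(0,2)$ (one block). $\langle p_1,\dots,p_n\rangle_{N\text{-lin}}$ is the smallest one containing $p_1,\dots,p_n$. For $p\in P(k,l)$ the map $T_p:(\mathbb C^N)^{\otimes k}\to(\mathbb C^N)^{\otimes l}$ is $T_p(e_{i_1}\otimes\cdots\otimes e_{i_k})=\sum_{j_1,\dots,j_l}\delta_p(\mathbf i,\mathbf j)\,e_{j_1}\otimes\cdots\otimes e_{j_l}$, with $\delta_p(\mathbf i,\mathbf j)=1$ if points in the same block carry equal indices and $0$ otherwise; extended linearly. The quantum group corresponding to a linear category of partitions $K$ is the (unique) $G\subset O_N^+$ with $\mathrm{Mor}(u^{\otimes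 k},u^{\otimes l})=\{T_p\mid p\in K(k,l)\}$ for all $k,l$; $O(G)$ is the universal $*$-algebra generated by $u_{ij}=u_{ij}^*$ with the relations $T_pu^{\otimes k}=u^{\otimes l}T_p$, $p\in K(k,l)$. **The quantum groups.** Let $N=4$, let $b_4\in P(0,4)$ be the one-block partition, $d\in P(1,1)$ the partition into two singletons, $\tau=\mathrm{id}-\tfrac12 d$, and $\mathcal T_{(4)}b_4:=\tau^{\otimes4}b_4\in P_{4\text{-lin}}(0,4)$. - $H_4^+$ (free hyperoctahedral quantum group) corresponds to $\langle b_4\rangle_{4\text{-lin}}$. - $D_4^+$ corresponds to $\langle \mathcal T_{(4)}b_4,\,b_4\rangle_{4\text{-lin}}$. - $D_4$ is the matrix group of all $4\times4$ signed permutation matrices $X$ with $\mathrm{perm}\,X=\sum_{\sigma\in S_4}X_{1\sigma(1)}\cdots X_{4\sigma(4)}=1$. *)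

(* Defs.v *)
From Stdlib Require List.
From HB Require Import structures.
From mathcomp Require Import all_boot all_order all_algebra.
From mathcomp Require Import fingroup perm generic_quotient.
From mathcomp Require Import complex.
From mathcomp Require Import boolp classical_sets functions reals.

Set Implicit Arguments.
Unset Strict Implicit.
Unset Printing Implicit Defensive.

Import Order.TTheory GRing.Theory Num.Theory.
Local Open Scope ring_scope.
Local Open Scope quotient_scope.

Section SetPartitions.
Variable T : finType.

Definition same_block (P : {set {set T}}) : rel T := fun x y => y \in finset.pblock P x.

(* The finest partition of T with e-related points in a common block. *)
Definition merge_set (e : rel T) : {set {set T}} :=
  equivalence_partition (connect (fun x y => e x y || e y x)) [set: T].

Lemma merge_equiv (e : rel T) :
  {in [set: T] & &, equivalence_rel (connect (fun x y => e x y || e y x))}.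
Proof.
have sym : connect_sym (fun x y => e x y || e y x).
  by apply: sym_connect_sym => x y; rewrite orbC.
by move=> x y z _ _ _; split=> [|/(same_connect sym)->] //; apply: connect0.
Qed.

Lemma merge_partition (e : rel T) : finset.partition (merge_set e) [set: T].
Proof. exact/equivalence_partitionP/merge_equiv. Qed.

Lemma same_block_merge (e : rel T) x y :
  same_block (merge_set e) x y = connect (fun x y => e x y || e y x) x y.
Proof.
by rewrite /same_block (pblock_equivalence_partition (@merge_equiv e)) ?inE.
Qed.

Definition block_constant (U : eqType) (P : {set {set T}}) (f : T -> U) : bool :=
  [forall x, forall y, same_block P x y ==> (f x == f y)].

Lemma block_constant_merge (U : eqType) (e : rel T) (f : T -> U) :
  block_constant (merge_set e) f = [forall x, forall y, e x y ==> (f x == f y)].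
Proof.
apply/forallP/forallP => fP x; apply/forallP => y; apply/implyP.
  move=> exy; move/forallP/(_ y)/implyP: (fP x); apply.
  by rewrite same_block_merge connect1 ?exy.
rewrite same_block_merge => /connectP[s]; elim: s x => [|z s IHs] x /=.
  by move=> _ ->.
case/andP=> xz /IHs{}IHs /IHs/eqP<-.
case/orP: xz => [xz|zx]; first by have /forallP/(_ z)/implyP := fP x; apply.
by rewrite eq_sym; have /forallP/(_ x)/implyP := fP z; apply.
Qed.
End SetPartitions.

Definition push_rel (S T : finType) (f : S -> T) (e : rel S) : rel T :=
  fun s t => [exists x, exists y, [&& e x y, f x == s & f y == t]].

(* Points inl are the upper ones and points inr the lower ones. *)
Definition parts (k l : nat) : predArgType :=
  {P : {set {set 'I_k + 'I_l}} | finset.partition P [set: 'I_k + 'I_l]}.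

Definition merge (k l : nat) (e : rel ('I_k + 'I_l)) : parts k l :=
  exist _ (merge_set e) (merge_partition e).

Definition linked (k l : nat) (p : parts k l) : rel ('I_k + 'I_l) :=
  same_block (val p).

Definition one_block (k l : nat) : parts k l := merge (fun _ _ => true).
Definition singletons (k l : nat) : parts k l := merge (fun _ _ => false).

Section Operations.
Variables k l m k' l' : nat.

Definition left_point (x : 'I_k + 'I_l) : 'I_(k + k') + 'I_(l + l') :=
  match x with inl i => inl (lshift k' i) | inr j => inr (lshift l' j) end.
Definition right_point (x : 'I_k' + 'I_l') : 'I_(k + k') + 'I_(l + l') :=
  match x with inl i => inl (rshift k i) | inr j => inr (rshift l j) end.

Definition part_tensor (p : parts k l) (q : parts k' l') : parts (k + k') (l + l') :=
  merge (fun x y => push_rel left_point (linked p) x y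
                 || push_rel right_point (linked q) x y).

Definition flip_point (x : 'I_k + 'I_l) : 'I_l + 'I_k :=
  match x with inl i => inr i | inr j => inl j end.

Definition part_flip (p : parts k l) : parts l k :=
  merge (push_rel flip_point (linked p)).

Definition upper_point (x : 'I_k + 'I_l) : 'I_k + 'I_l + 'I_m := inl x.
Definition lower_point (y : 'I_l + 'I_m) : 'I_k + 'I_l + 'I_m :=
  match y with inl i => inl (inr i) | inr j => inr j end.
Definition outer_point (z : 'I_k + 'I_m) : 'I_k + 'I_l + 'I_m :=
  match z with inl i => inl (inl i) | inr j => inr j end.

Definition glue (q : parts l m) (p : parts k l) : {set {set 'I_k + 'I_l + 'I_m}} :=
  merge_set (fun x y => push_rel upper_point (linked p) x y
                     || push_rel lower_point (linked q) x y).

Definition part_comp (q : parts l m) (p : parts k l) : parts k m :=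
  merge (fun x y => same_block (glue q p) (outer_point x) (outer_point y)).

(* The number of components of the glued diagram that get removed. *)
Definition loops (q : parts l m) (p : parts k l) : nat :=
  #|[set B in glue q p | [forall z, outer_point z \notin B]]|.
End Operations.

Section LinearPartitions.
Variable C : numClosedFieldType.

Definition plin (k l : nat) : predArgType := {ffun parts k l -> C^o}.
HB.instance Definition _ k l := GRing.Lmodule.on (plin k l).

Definition pbasis (k l : nat) (p : parts k l) : plin k l :=
  [ffun q => (q == p)%:R].

Definition lin_tensor k l k' l' (f : plin k l) (g : plin k' l') :
    plin (k + k') (l + l') :=
  \sum_p \sum_q (f p * g q) *: pbasis (part_tensor p q).

Definition lin_flip k l (f : plin k l) : plin l k :=
  \sum_p (f p)^* *: pbasis (part_flip p).

(* The composite g f, with g below f. *)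
Definition lin_comp (N : nat) k l m (g : plin l m) (f : plin k l) : plin k m :=
  \sum_q \sum_p (g q * f p * N%:R ^+ loops q p) *: pbasis (part_comp q p).

Record linear_category (N : nat) (K : forall k l, plin k l -> Prop) : Prop := {
  lincat0 : forall k l, K k l 0;
  lincatP : forall k l (a : C) (f g : plin k l),
    K k l f -> K k l g -> K k l (a *: f + g);
  lincat_tensor : forall k l k' l' (f : plin k l) (g : plin k' l'),
    K k l f -> K k' l' g -> K (k + k')%N (l + l')%N (lin_tensor f g);
  lincat_comp : forall k l m (g : plin l m) (f : plin k l),
    K l m g -> K k l f -> K k m (lin_comp N g f);
  lincat_flip : forall k l (f : plin k l), K k l f -> K l k (lin_flip f);
  lincat_id : K 1 1 (pbasis (one_block 1 1));
  lincat_pair : K 0 2 (pbasis (one_block 0 2))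
}.

Definition lin_span (N : nat) (s : seq {kl : nat * nat & plin kl.1 kl.2})
    (k l : nat) (f : plin k l) : Prop :=
  forall K : forall k l, plin k l -> Prop, linear_category N K ->
    (forall g, List.In g s -> K _ _ (tagged g)) -> K k l f.

Lemma lin_spanP N s : linear_category N (@lin_span N s).
Proof.
split.
- by move=> k l K KP _; apply: lincat0 KP k l.
- move=> k l a f g Kf Kg K KP sK.
  by apply: (lincatP KP); [apply: Kf|apply: Kg].
- move=> k l k' l' f g Kf Kg K KP sK.
  by apply: (lincat_tensor KP); [apply: Kf|apply: Kg].
- move=> k l m f g Kf Kg K KP sK.
  by apply: (lincat_comp KP); [apply: Kf|apply: Kg].
- by move=> k l f Kf K KP sK; apply: (lincat_flip KP); apply: Kf.
- by move=> K KP _; apply: lincat_id KP.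
- by move=> K KP _; apply: lincat_pair KP.
Qed.

Definition b4 : plin 0 4 := pbasis (one_block 0 4).

Definition tau4 : plin 1 1 :=
  pbasis (one_block 1 1) - 2^-1 *: pbasis (singletons 1 1).

(* tau^(x)4 composed with b4, for N = 4. *)
Definition T4b4 : plin 0 4 :=
  lin_comp 4 (lin_tensor (lin_tensor (lin_tensor tau4 tau4) tau4) tau4) b4.

Section Maps.
Variable N : nat.

(* The index of a basis vector of the k-th tensor power of C^N. *)
Definition multi (k : nat) : finType := {ffun 'I_k -> 'I_N}.

Definition labels k l (i : multi k) (j : multi l) (x : 'I_k + 'I_l) : 'I_N :=
  match x with inl a => i a | inr b => j b end.

(* The (j, i) entry of the matrix of T_f. *)
Definition Tmap k l (f : plin k l) (j : multi l) (i : multi k) : C :=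
  \sum_p f p * (block_constant (val p) (labels i j))%:R.

Lemma Tmap_basis k l (p : parts k l) j i :
  Tmap (pbasis p) j i = (block_constant (val p) (labels i j))%:R.
Proof.
rewrite /Tmap (bigD1 p) //= ffunE eqxx mul1r big1 ?addr0 // => q /negPf qp.
by rewrite ffunE qp mul0r.
Qed.
End Maps.
End LinearPartitions.

Local Open Scope classical_set_scope.

(* Unital star-algebras over C, the statement being about C := R[i]. The    *)
(* algebra structure is the unital ring morphism [scal] into the centre:    *)
(* [algType] would exclude the zero algebra, which a quotient may be.       *)
HB.mixin Record isStarAlgebra (C : numClosedFieldType) A of GRing.PzRing A := {
  scal : C -> A;
  star : A -> A;
  scal1 : scal 1 = 1;
  scalD : forall a b, scal (a + b) = scal a + scal b;
  scalM : forall a b, scal (a * b) = scal a * scal b;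
  scalC : forall a x, scal a * x = x * scal a;
  starK : involutive star;
  starD : forall x y, star (x + y) = star x + star y;
  starM : forall x y, star (x * y) = star y * star x;
  star_scal : forall a, star (scal a) = scal a^*
}.

#[short(type="starAlgType")]
HB.structure Definition StarAlgebra (C : numClosedFieldType) :=
  {A of GRing.PzRing A & isStarAlgebra C A}.

HB.mixin Record isStarPreserving (C : numClosedFieldType)
    (A B : starAlgType C) (f : A -> B) := {
  hom_scal : forall a, f (scal a) = scal a;
  hom_star : forall x, f (star x) = star (f x)
}.

HB.structure Definition StarHom (C : numClosedFieldType) (A B : starAlgType C) :=
  {f of @GRing.RMorphism A B f & @isStarPreserving C A B f}.

Notation "{ 'starhom' A -> B }" := (@StarHom.type _ A%type B%type)
  (at level 0, A at level 98, B at level 99, format "{ 'starhom'  A  ->  B }").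

Section StarTheory.
Variables (C : numClosedFieldType) (A : starAlgType C).
Implicit Types (a : C) (x y : A).

Lemma scal0 : scal 0 = 0 :> A.
Proof. by apply: (addrI (scal 0)); rewrite -scalD !addr0. Qed.

Lemma scalN1 x : scal (- 1) * x = - x.
Proof.
rewrite -[LHS]mul1r -scal1 mulrA -scalM mul1r; apply: (addrI x).
by rewrite subrr -{1}[x]mul1r -scal1 -mulrDl -scalD subrr scal0 mul0r.
Qed.

Lemma star0 : star 0 = 0 :> A.
Proof. by apply: (addrI (star 0)); rewrite -starD !addr0. Qed.

Lemma star1 : star 1 = 1 :> A.
Proof. by rewrite -[LHS]mul1r -{1}[1]starK -starM mul1r starK. Qed.

Lemma starN x : star (- x) = - star x.
Proof. by apply: (addrI (star x)); rewrite -starD !subrr star0. Qed.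

Lemma star_sum I (r : seq I) (P : pred I) (F : I -> A) :
  star (\sum_(i <- r | P i) F i) = \sum_(i <- r | P i) star (F i).
Proof. exact: (big_morph _ starD star0). Qed.

Record star_subalgebra (B : set A) : Prop := {
  subalg_scal : forall a, B (scal a);
  subalgD : forall x y, B x -> B y -> B (x + y);
  subalgM : forall x y, B x -> B y -> B (x * y);
  subalg_star : forall x, B x -> B (star x)
}.

Definition star_span (S : set A) : set A :=
  [set x | forall B, star_subalgebra B -> S `<=` B -> B x].

Definition generates (S : set A) : Prop := star_span S = setT.

Record star_ideal (I : set A) : Prop := {
  ideal0 : I 0;
  idealD : forall x y, I x -> I y -> I (x + y);
  idealMl : forall x y, I y -> I (x * y);
  idealMr : forall x y, I x -> I (x * y);
  ideal_star : forall x, I x -> I (star x)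
}.

Definition ideal_span (S : set A) : set A :=
  [set x | forall I, star_ideal I -> S `<=` I -> I x].

Lemma star_spanP S : star_subalgebra (star_span S).
Proof.
split=> [a B BP _|x y Bx By B BP SB|x y Bx By B BP SB|x Bx B BP SB].
- exact: subalg_scal.
- by apply: subalgD => //; [exact: Bx|exact: By].
- by apply: subalgM => //; [exact: Bx|exact: By].
- by apply: subalg_star => //; exact: Bx.
Qed.

Lemma sub_star_span S : S `<=` star_span S.
Proof. by move=> x Sx B _; apply. Qed.

Lemma ideal_spanP S : star_ideal (ideal_span S).
Proof.
split=> [I IP _|x y Ix Iy I IP SI|x y Iy I IP SI|x y Ix I IP SI|x Ix I IP SI].
- exact: ideal0.
- by apply: idealD => //; [exact: Ix|exact: Iy].
- by apply: idealMl => //; exact: Iy.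
- by apply: idealMr => //; exact: Ix.
- by apply: ideal_star => //; exact: Ix.
Qed.

Lemma sub_ideal_span S : S `<=` ideal_span S.
Proof. by move=> x Sx I _; apply. Qed.

Section Ideal.
Variables (I : set A) (IP : star_ideal I).
Lemma idealN x : I x -> I (- x).
Proof. by rewrite -mulN1r; apply: idealMl. Qed.
Lemma idealB x y : I x -> I y -> I (x - y).
Proof. by move=> Ix /idealN; apply: idealD. Qed.
End Ideal.
End StarTheory.

(* The quotient of A by the star-ideal generated by S, i.e. by the          *)
(* relations x = 0 for x in S.                                              *)
Section Quotient.
Variables (C : numClosedFieldType) (A : starAlgType C) (S : set A).

Definition quo_rel : rel A := fun x y => `[< ideal_span S (x - y) >].

Let IS := ideal_spanP S.

Lemma quo_rel_equiv : equiv_class_of quo_rel.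
Proof.
apply: EquivClass => [x|x y|y x z].
- by apply/asboolP; rewrite subrr; apply: ideal0.
- by apply/asboolP/asboolP => /(idealN IS); rewrite opprB.
- move=> /asboolP xy /asboolP yz; apply/asboolP.
  by have := idealD IS xy yz; rewrite addrA subrK.
Qed.
Canonical quo_equiv : equiv_rel A := EquivRelPack quo_rel_equiv.

Definition quotient : Type := {eq_quot quo_equiv}.
HB.instance Definition _ := Choice.on quotient.

Definition quo_pi (x : A) : quotient := \pi_({eq_quot quo_equiv}) x.
Definition quo_repr (q : quotient) : A := repr (q : {eq_quot quo_equiv}).

Lemma quo_reprK q : quo_pi (quo_repr q) = q.
Proof. exact: reprK. Qed.

Lemma quo_piE x y : quo_pi x = quo_pi y <-> ideal_span S (x - y).
Proof.
split=> [xy|xy]; last exact/eqmodP/asboolP.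
by move: xy => /(@eqmodP _ quo_equiv)/asboolP.
Qed.

Lemma quo_repr_pi x : ideal_span S (quo_repr (quo_pi x) - x).
Proof. by apply/quo_piE; rewrite quo_reprK. Qed.

Let qop2 (f : A -> A -> A) p q := quo_pi (f (quo_repr p) (quo_repr q)).
Let qop1 (f : A -> A) p := quo_pi (f (quo_repr p)).

Let qaddE x y : qop2 +%R (quo_pi x) (quo_pi y) = quo_pi (x + y).
Proof.
apply/quo_piE; rewrite opprD addrACA.
by apply: (idealD IS) => //; apply: quo_repr_pi.
Qed.

Let qmulE x y : qop2 *%R (quo_pi x) (quo_pi y) = quo_pi (x * y).
Proof.
apply/quo_piE; set x' := quo_repr _; set y' := quo_repr _.
have -> : x' * y' - x * y = x' * (y' - y) + (x' - x) * y.
  by rewrite mulrBr mulrBl addrA subrK.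
by apply: (idealD IS) => //; [apply: (idealMl IS)|apply: (idealMr IS)] => //; apply: quo_repr_pi.
Qed.

Let qoppE x : qop1 -%R (quo_pi x) = quo_pi (- x).
Proof.
by apply/quo_piE; rewrite -opprD; apply: (idealN IS) => //; apply: quo_repr_pi.
Qed.

Let qstarE x : qop1 (@star C A) (quo_pi x) = quo_pi (star x).
Proof.
apply/quo_piE; rewrite -starN -starD.
by apply: (ideal_star IS) => //; apply: quo_repr_pi.
Qed.

Let surj (P : quotient -> Prop) : (forall x, P (quo_pi x)) -> forall q, P q.
Proof. by move=> PP q; rewrite -[q]quo_reprK. Qed.

Let qaddA : associative (qop2 +%R).
Proof. by elim/surj=> x; elim/surj=> y; elim/surj=> z; rewrite !qaddE addrA. Qed.
Let qaddC : commutative (qop2 +%R).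
Proof. by elim/surj=> x; elim/surj=> y; rewrite !qaddE addrC. Qed.
Let qadd0 : left_id (quo_pi 0) (qop2 +%R).
Proof. by elim/surj=> x; rewrite qaddE add0r. Qed.
Let qaddN : left_inverse (quo_pi 0) (qop1 -%R) (qop2 +%R).
Proof. by elim/surj=> x; rewrite qoppE qaddE addNr. Qed.
HB.instance Definition _ :=
  GRing.isZmodule.Build quotient qaddA qaddC qadd0 qaddN.

Let piD x y : quo_pi x + quo_pi y = quo_pi (x + y). Proof. exact: qaddE. Qed.

Let qmulA : associative (qop2 *%R).
Proof. by elim/surj=> x; elim/surj=> y; elim/surj=> z; rewrite !qmulE mulrA. Qed.
Let qmul1 : left_id (quo_pi 1) (qop2 *%R).
Proof. by elim/surj=> x; rewrite qmulE mul1r. Qed.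
Let qmulr1 : right_id (quo_pi 1) (qop2 *%R).
Proof. by elim/surj=> x; rewrite qmulE mulr1. Qed.
Let qmulDl : left_distributive (qop2 *%R) +%R.
Proof.
elim/surj=> x; elim/surj=> y; elim/surj=> z.
by rewrite piD !qmulE piD mulrDl.
Qed.
Let qmulDr : right_distributive (qop2 *%R) +%R.
Proof.
elim/surj=> x; elim/surj=> y; elim/surj=> z.
by rewrite piD !qmulE piD mulrDr.
Qed.
HB.instance Definition _ :=
  GRing.Zmodule_isPzRing.Build quotient qmulA qmul1 qmulr1 qmulDl qmulDr.

Let piM x y : quo_pi x * quo_pi y = quo_pi (x * y). Proof. exact: qmulE. Qed.
Let q_scal1 : quo_pi (scal 1) = 1.
Proof. by rewrite scal1. Qed.
Let q_scalD (a b : C) : quo_pi (scal (a + b)) = quo_pi (scal a) + quo_pi (scal b).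
Proof. by rewrite piD scalD. Qed.
Let q_scalM (a b : C) : quo_pi (scal (a * b)) = quo_pi (scal a) * quo_pi (scal b).
Proof. by rewrite piM scalM. Qed.
Let q_scalC (a : C) q : quo_pi (scal a) * q = q * quo_pi (scal a).
Proof. by elim/surj: q => x; rewrite !piM scalC. Qed.
Let q_starK : involutive (qop1 (@star C A)).
Proof. by elim/surj=> x; rewrite !qstarE starK. Qed.
Let q_starD x y : qop1 (@star C A) (x + y) = qop1 (@star C A) x + qop1 (@star C A) y.
Proof.
by elim/surj: x => x; elim/surj: y => y; rewrite piD !qstarE piD starD.
Qed.
Let q_starM x y : qop1 (@star C A) (x * y) = qop1 (@star C A) y * qop1 (@star C A) x.
Proof.
by elim/surj: x => x; elim/surj: y => y; rewrite piM !qstarE piM starM.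
Qed.
Let q_star_scal (a : C) :
  qop1 (@star C A) (quo_pi (scal a)) = quo_pi (scal a^*).
Proof. by rewrite qstarE star_scal. Qed.
HB.instance Definition _ := isStarAlgebra.Build C quotient
  q_scal1 q_scalD q_scalM q_scalC q_starK q_starD q_starM q_star_scal.

Let pi_nmod : nmod_morphism quo_pi.
Proof. by split=> // x y; rewrite piD. Qed.
HB.instance Definition _ := GRing.isNmodMorphism.Build A quotient quo_pi pi_nmod.
Let pi_mon : monoid_morphism quo_pi.
Proof. by split=> // x y; rewrite piM. Qed.
HB.instance Definition _ := GRing.isMonoidMorphism.Build A quotient quo_pi pi_mon.
Let pi_star x : quo_pi (star x) = star (quo_pi x).
Proof. by rewrite -qstarE. Qed.
HB.instance Definition _ := isStarPreserving.Build C A quotient quo_pi (fun=> erefl) pi_star.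

Lemma quo_pi_eq0 x : S x -> quo_pi x = 0.
Proof.
move=> Sx; rewrite -[RHS](rmorph0 quo_pi); apply/quo_piE.
by rewrite subr0; apply: sub_ideal_span.
Qed.

Lemma quo_surj q : exists x, quo_pi x = q.
Proof. by exists (quo_repr q); rewrite quo_reprK. Qed.

Section Lift.
Variables (B : starAlgType C) (f : {starhom A -> B}).
Hypothesis fS : forall x, S x -> f x = 0.

Lemma lift_ker x : ideal_span S x -> f x = 0.
Proof.
move=> Ix; apply: (Ix [set y | f y = 0]); last exact: fS.
split=> [|y z /= fy fz|y z /= fz|y z /= fy|y /= fy].
- exact: rmorph0.
- by rewrite rmorphD /= fy fz addr0.
- by rewrite rmorphM /= fz mulr0.
- by rewrite rmorphM /= fy mul0r.
- by rewrite hom_star fy star0.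
Qed.

Definition quo_lift (q : quotient) : B := f (quo_repr q).

Lemma quo_lift_pi x : quo_lift (quo_pi x) = f x.
Proof.
apply: subr0_eq; rewrite -[LHS]rmorphB; apply: lift_ker; exact: quo_repr_pi.
Qed.

Lemma quo_lift_hom : exists g : {starhom quotient -> B},
  forall x, g (quo_pi x) = f x.
Proof.
have gN : nmod_morphism quo_lift.
  split; first by rewrite -(rmorph0 quo_pi) quo_lift_pi rmorph0.
  by elim/surj=> x; elim/surj=> y; rewrite -rmorphD !quo_lift_pi rmorphD.
have gM : monoid_morphism quo_lift.
  split; first by rewrite -(rmorph1 quo_pi) quo_lift_pi rmorph1.
  by elim/surj=> x; elim/surj=> y; rewrite -rmorphM !quo_lift_pi rmorphM.
have gZ a : quo_lift (scal a) = scal a.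
  by rewrite (_ : scal a = quo_pi (scal a)) // quo_lift_pi hom_scal.
have gS x : quo_lift (star x) = star (quo_lift x).
  by elim/surj: x => x; rewrite -hom_star !quo_lift_pi hom_star.
pose h1 := GRing.isNmodMorphism.Build quotient B quo_lift gN.
pose h2 := GRing.isMonoidMorphism.Build quotient B quo_lift gM.
pose h4 := isStarPreserving.Build C quotient B quo_lift gZ gS.
pose g : {starhom quotient -> B} := HB.pack quo_lift h1 h2 h4.
by exists g => x; rewrite -quo_lift_pi.
Qed.
End Lift.
End Quotient.

(* The free star-algebra on X: formal star-algebra expressions modulo the   *)
(* smallest congruence containing the star-algebra axioms.                  *)
Section Free.
Variables (C : numClosedFieldType) (X : Type).

Inductive sterm : Type :=
| SGen of X
| SScal of C
| SAdd of sterm & sterm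
| SMul of sterm & sterm
| SStar of sterm.

Inductive sterm_eq : sterm -> sterm -> Prop :=
| se_refl s : sterm_eq s s
| se_sym s t : sterm_eq s t -> sterm_eq t s
| se_trans t s r : sterm_eq s t -> sterm_eq t r -> sterm_eq s r
| se_add s s' t t' : sterm_eq s s' -> sterm_eq t t' ->
    sterm_eq (SAdd s t) (SAdd s' t')
| se_mul s s' t t' : sterm_eq s s' -> sterm_eq t t' ->
    sterm_eq (SMul s t) (SMul s' t')
| se_star s s' : sterm_eq s s' -> sterm_eq (SStar s) (SStar s')
| se_addA s t r : sterm_eq (SAdd s (SAdd t r)) (SAdd (SAdd s t) r)
| se_addC s t : sterm_eq (SAdd s t) (SAdd t s)
| se_add0 s : sterm_eq (SAdd (SScal 0) s) s
| se_addN s : sterm_eq (SAdd (SMul (SScal (- 1)) s) s) (SScal 0)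
| se_mulA s t r : sterm_eq (SMul s (SMul t r)) (SMul (SMul s t) r)
| se_mul1 s : sterm_eq (SMul (SScal 1) s) s
| se_mulDl s t r : sterm_eq (SMul (SAdd s t) r) (SAdd (SMul s r) (SMul t r))
| se_mulDr s t r : sterm_eq (SMul s (SAdd t r)) (SAdd (SMul s t) (SMul s r))
| se_scalD a b : sterm_eq (SScal (a + b)) (SAdd (SScal a) (SScal b))
| se_scalM a b : sterm_eq (SScal (a * b)) (SMul (SScal a) (SScal b))
| se_scalC a s : sterm_eq (SMul (SScal a) s) (SMul s (SScal a))
| se_starK s : sterm_eq (SStar (SStar s)) s
| se_starD s t : sterm_eq (SStar (SAdd s t)) (SAdd (SStar s) (SStar t))
| se_starM s t : sterm_eq (SStar (SMul s t)) (SMul (SStar t) (SStar s))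
| se_star_scal a : sterm_eq (SStar (SScal a)) (SScal a^*).

HB.instance Definition _ := gen_eqMixin sterm.
HB.instance Definition _ := gen_choiceMixin sterm.

Definition sterm_rel : rel sterm := fun s t => `[< sterm_eq s t >].

Lemma sterm_rel_equiv : equiv_class_of sterm_rel.
Proof.
apply: EquivClass => [x|x y|y x z].
- exact/asboolP/se_refl.
- by apply/asboolP/asboolP => /se_sym.
- by move=> /asboolP xy /asboolP yz; apply/asboolP; apply: se_trans xy yz.
Qed.
Canonical sterm_equiv : equiv_rel sterm := EquivRelPack sterm_rel_equiv.

Definition free : Type := {eq_quot sterm_equiv}.
HB.instance Definition _ := Choice.on free.

Definition free_pi (s : sterm) : free := \pi_({eq_quot sterm_equiv}) s.
Definition free_repr (q : free) : sterm := repr (q : {eq_quot sterm_equiv}).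
Definition gen (x : X) : free := free_pi (SGen x).

Let reprK q : free_pi (free_repr q) = q.
Proof. exact: reprK. Qed.

Let piE s t : sterm_eq s t -> free_pi s = free_pi t.
Proof. by move=> st; apply/(@eqmodP _ sterm_equiv)/asboolP. Qed.

Let piE' s t : free_pi s = free_pi t -> sterm_eq s t.
Proof. by move=> /(@eqmodP _ sterm_equiv)/asboolP. Qed.

Let repr_pi s : sterm_eq (free_repr (free_pi s)) s.
Proof. by apply: piE'; rewrite reprK. Qed.

Let surj (P : free -> Prop) : (forall x, P (free_pi x)) -> forall q, P q.
Proof. by move=> PP q; rewrite -[q]reprK. Qed.

Let fadd p q := free_pi (SAdd (free_repr p) (free_repr q)).
Let fmul p q := free_pi (SMul (free_repr p) (free_repr q)).
Let fopp p := free_pi (SMul (SScal (- 1)) (free_repr p)).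
Let fstar p := free_pi (SStar (free_repr p)).

Let faddE s t : fadd (free_pi s) (free_pi t) = free_pi (SAdd s t).
Proof. by apply/piE/se_add. Qed.
Let fmulE s t : fmul (free_pi s) (free_pi t) = free_pi (SMul s t).
Proof. by apply/piE/se_mul. Qed.
Let foppE s : fopp (free_pi s) = free_pi (SMul (SScal (- 1)) s).
Proof. by apply/piE/se_mul => //; apply: se_refl. Qed.
Let fstarE s : fstar (free_pi s) = free_pi (SStar s).
Proof. by apply/piE/se_star. Qed.

Let faddA : associative fadd.
Proof.
by elim/surj=> x; elim/surj=> y; elim/surj=> z; rewrite !faddE; apply/piE/se_addA.
Qed.
Let faddC : commutative fadd.
Proof. by elim/surj=> x; elim/surj=> y; rewrite !faddE; apply/piE/se_addC. Qed.
Let fadd0 : left_id (free_pi (SScal 0)) fadd.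
Proof. by elim/surj=> x; rewrite !faddE; apply/piE/se_add0. Qed.
Let faddN : left_inverse (free_pi (SScal 0)) fopp fadd.
Proof. by elim/surj=> x; rewrite foppE !faddE; apply/piE/se_addN. Qed.
HB.instance Definition _ :=
  GRing.isZmodule.Build free faddA faddC fadd0 faddN.

Let piD s t : free_pi s + free_pi t = free_pi (SAdd s t).
Proof. exact: faddE. Qed.

Let fmulA : associative fmul.
Proof.
by elim/surj=> x; elim/surj=> y; elim/surj=> z; rewrite !fmulE; apply/piE/se_mulA.
Qed.
Let fmul1 : left_id (free_pi (SScal 1)) fmul.
Proof. by elim/surj=> x; rewrite !fmulE; apply/piE/se_mul1. Qed.
Let fmulr1 : right_id (free_pi (SScal 1)) fmul.
Proof.
elim/surj=> x; rewrite fmulE; apply: piE.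
by apply: se_trans (se_mul1 x); apply/se_sym/se_scalC.
 Qed.
Let fmulDl : left_distributive fmul +%R.
Proof.
elim/surj=> x; elim/surj=> y; elim/surj=> z.
by rewrite piD !fmulE piD; apply/piE/se_mulDl.
Qed.
Let fmulDr : right_distributive fmul +%R.
Proof.
elim/surj=> x; elim/surj=> y; elim/surj=> z.
by rewrite piD !fmulE piD; apply/piE/se_mulDr.
Qed.
HB.instance Definition _ :=
  GRing.Zmodule_isPzRing.Build free fmulA fmul1 fmulr1 fmulDl fmulDr.

Let piM s t : free_pi s * free_pi t = free_pi (SMul s t).
Proof. exact: fmulE. Qed.
Let fscal a := free_pi (SScal a).
Let f_scal1 : fscal 1 = 1. Proof. by []. Qed.
Let f_scalD a b : fscal (a + b) = fscal a + fscal b.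
Proof. by rewrite piD; apply/piE/se_scalD. Qed.
Let f_scalM a b : fscal (a * b) = fscal a * fscal b.
Proof. by rewrite piM; apply/piE/se_scalM. Qed.
Let f_scalC a x : fscal a * x = x * fscal a.
Proof. by elim/surj: x => x; rewrite !piM; apply/piE/se_scalC. Qed.
Let f_starK : involutive fstar.
Proof. by elim/surj=> x; rewrite !fstarE; apply/piE/se_starK. Qed.
Let f_starD x y : fstar (x + y) = fstar x + fstar y.
Proof.
elim/surj: x => x; elim/surj: y => y; rewrite piD !fstarE piD.
exact/piE/se_starD.
Qed.
Let f_starM x y : fstar (x * y) = fstar y * fstar x.
Proof.
elim/surj: x => x; elim/surj: y => y; rewrite piM !fstarE piM.
exact/piE/se_starM.
Qed.
Let f_star_scal a : fstar (fscal a) = fscal a^*.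
Proof. by rewrite fstarE; apply/piE/se_star_scal. Qed.
HB.instance Definition _ := isStarAlgebra.Build C free
  f_scal1 f_scalD f_scalM f_scalC f_starK f_starD f_starM f_star_scal.

Let piS s : star (free_pi s) = free_pi (SStar s).
Proof. exact: fstarE. Qed.

Lemma free_generated : generates (range gen).
Proof.
apply/seteqP; split=> // q _ B BP gB.
elim/surj: q; elim=> [x|a|s IHs t IHt|s IHs t IHt|s IHs].
- by apply: gB; exists x.
- exact: (subalg_scal BP a).
- by rewrite -piD; apply: subalgD.
- by rewrite -piM; apply: subalgM.
- by rewrite -piS; apply: subalg_star.
Qed.

Section Lift.
Variables (B : starAlgType C) (v : X -> B).

Fixpoint sterm_eval (s : sterm) : B :=
  match s with
  | SGen x => v x
  | SScal a => scal a
  | SAdd s t => sterm_eval s + sterm_eval t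
  | SMul s t => sterm_eval s * sterm_eval t
  | SStar s => star (sterm_eval s)
  end.

Lemma sterm_eval_eq s t : sterm_eq s t -> sterm_eval s = sterm_eval t.
Proof.
elim=> //=.
- by move=> ? ? ? _ -> _ ->.
- by move=> ? ? ? ? _ -> _ ->.
- by move=> ? ? ? ? _ -> _ ->.
- by move=> ? ? _ ->.
- by move=> *; rewrite addrA.
- by move=> *; rewrite addrC.
- by move=> *; rewrite scal0 add0r.
- by move=> *; rewrite scalN1 scal0 addNr.
- by move=> *; rewrite mulrA.
- by move=> *; rewrite scal1 mul1r.
- by move=> *; rewrite mulrDl.
- by move=> *; rewrite mulrDr.
- by move=> *; rewrite scalD.
- by move=> *; rewrite scalM.
- by move=> *; rewrite scalC.
- by move=> *; rewrite starK.
- by move=> *; rewrite starD.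
- by move=> *; rewrite starM.
- by move=> *; rewrite star_scal.
Qed.

Definition free_lift (q : free) : B := sterm_eval (free_repr q).

Lemma free_lift_pi s : free_lift (free_pi s) = sterm_eval s.
Proof. exact/sterm_eval_eq/repr_pi. Qed.

Lemma free_lift_hom : exists g : {starhom free -> B}, forall x, g (gen x) = v x.
Proof.
have gN : nmod_morphism free_lift.
  split; first exact: (etrans (free_lift_pi (SScal 0)) (@scal0 C B)).
  by elim/surj=> x; elim/surj=> y; rewrite piD !free_lift_pi.
have gM : monoid_morphism free_lift.
  split; first exact: (etrans (free_lift_pi (SScal 1)) scal1).
  by elim/surj=> x; elim/surj=> y; rewrite piM !free_lift_pi.
have gZ a : free_lift (scal a) = scal a by exact: free_lift_pi.
have gS x : free_lift (star x) = star (free_lift x).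
  by elim/surj: x => x; rewrite piS !free_lift_pi.
pose h1 := GRing.isNmodMorphism.Build free B free_lift gN.
pose h2 := GRing.isMonoidMorphism.Build free B free_lift gM.
pose h4 := isStarPreserving.Build C free B free_lift gZ gS.
pose g : {starhom free -> B} := HB.pack free_lift h1 h2 h4.
by exists g => x; rewrite /= free_lift_pi.
Qed.
End Lift.
End Free.

Section SubAlgebra.
Variables (C : numClosedFieldType) (A : starAlgType C) (S : set A).

Definition in_span : {pred A} := fun x => `[< star_span S x >].
Definition subalgebra : Type := {x : A | x \in in_span}.
HB.instance Definition _ := [isSub of subalgebra for @sval A _].
HB.instance Definition _ := [Choice of subalgebra by <:].

Let SS := star_spanP S.

Lemma in_span_subring : subring_closed in_span.
Proof.
have opp x : x \in in_span -> - x \in in_span.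
  move=> /asboolP Sx; apply/asboolP; rewrite -scalN1.
  by apply: (subalgM SS) => //; apply: (subalg_scal SS).
split=> [|x y xS /opp|x y]; first apply/asboolP.
- by rewrite -scal1; apply: (subalg_scal SS).
- by move: xS => /asboolP Sx /asboolP Sy; apply/asboolP; apply: (subalgD SS).
- by move=> /asboolP Sx /asboolP Sy; apply/asboolP; apply: (subalgM SS).
Qed.
HB.instance Definition _ :=
  GRing.SubChoice_isSubPzRing.Build A in_span subalgebra in_span_subring.

Let sscal (a : C) : subalgebra :=
  Sub (scal a) (introT (asboolP _) (subalg_scal SS a)).
Let sstar (x : subalgebra) : subalgebra :=
  Sub (star (val x)) (introT (asboolP _) (subalg_star SS (elimT (asboolP _) (valP x)))).

Let s_scal1 : sscal 1 = 1. Proof. by apply: val_inj; rewrite rmorph1 /= scal1. Qed.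
Let s_scalD a b : sscal (a + b) = sscal a + sscal b.
Proof. by apply: val_inj; rewrite rmorphD /= scalD. Qed.
Let s_scalM a b : sscal (a * b) = sscal a * sscal b.
Proof. by apply: val_inj; rewrite rmorphM /= scalM. Qed.
Let s_scalC a x : sscal a * x = x * sscal a.
Proof. by apply: val_inj; rewrite !rmorphM /= scalC. Qed.
Let s_starK : involutive sstar.
Proof. by move=> x; apply: val_inj; rewrite /= starK. Qed.
Let s_starD x y : sstar (x + y) = sstar x + sstar y.
Proof. by apply: val_inj; rewrite /= starD. Qed.
Let s_starM x y : sstar (x * y) = sstar y * sstar x.
Proof. by apply: val_inj; rewrite /= starM. Qed.
Let s_star_scal a : sstar (sscal a) = sscal a^*.
Proof. by apply: val_inj; rewrite /= star_scal. Qed.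
HB.instance Definition _ := isStarAlgebra.Build C subalgebra
  s_scal1 s_scalD s_scalM s_scalC s_starK s_starD s_starM s_star_scal.

Definition in_subalgebra (x : A) (Sx : S x) : subalgebra :=
  Sub x (introT (asboolP _) (sub_star_span Sx)).
End SubAlgebra.

Section Functions.
Variables (C : numClosedFieldType) (T : Type).
Implicit Types f g : T -> C.

Let fscal (a : C) : T -> C := fun=> a.
Let fstar f : T -> C := fun x => (f x)^*.
Let fscal1 : fscal 1 = 1. Proof. by []. Qed.
Let fscalD a b : fscal (a + b) = fscal a + fscal b. Proof. by []. Qed.
Let fscalM a b : fscal (a * b) = fscal a * fscal b. Proof. by []. Qed.
Let fscalC a f : fscal a * f = f * fscal a.
Proof. exact: mulrC. Qed.
Let fstarK : involutive fstar.
Proof. by move=> f; apply/funext => x; apply: conjCK. Qed.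
Let fstarD f g : fstar (f + g) = fstar f + fstar g.
Proof. by apply/funext => x; apply: rmorphD. Qed.
Let fstarM f g : fstar (f * g) = fstar g * fstar f.
Proof. by rewrite mulrC; apply/funext => x; apply: rmorphM. Qed.
Let fstar_scal a : fstar (fscal a) = fscal a^*. Proof. by []. Qed.
HB.instance Definition _ := isStarAlgebra.Build C (T -> C)
  fscal1 fscalD fscalM fscalC fstarK fstarD fstarM fstar_scal.
End Functions.

(* The algebraic tensor product of star-algebras, presented as the          *)
(* universal star-algebra generated by commuting copies of A and B;         *)
(* x (x) y is [tensl x * tensr y].                                          *)
Section Tensor.
Variables (C : numClosedFieldType) (A B : starAlgType C).

Let inA (x : A) : free C (A + B) := gen C (inl x).
Let inB (y : B) : free C (A + B) := gen C (inr y).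

Inductive tensor_rel : free C (A + B) -> Prop :=
| tensor_addl x x' : tensor_rel (inA (x + x') - (inA x + inA x'))
| tensor_mull x x' : tensor_rel (inA (x * x') - inA x * inA x')
| tensor_scall a : tensor_rel (inA (scal a) - scal a)
| tensor_starl x : tensor_rel (inA (star x) - star (inA x))
| tensor_addr y y' : tensor_rel (inB (y + y') - (inB y + inB y'))
| tensor_mulr y y' : tensor_rel (inB (y * y') - inB y * inB y')
| tensor_scalr a : tensor_rel (inB (scal a) - scal a)
| tensor_starr y : tensor_rel (inB (star y) - star (inB y))
| tensor_comm x y : tensor_rel (inA x * inB y - inB y * inA x).

Definition tensor : Type := quotient (tensor_rel : set _).
HB.instance Definition _ := StarAlgebra.on tensor.

Definition tensl (x : A) : tensor := quo_pi (tensor_rel : set _) (inA x).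
Definition tensr (y : B) : tensor := quo_pi (tensor_rel : set _) (inB y).

Let rel_eq x y : tensor_rel (x - y) ->
  quo_pi (tensor_rel : set _) x = quo_pi (tensor_rel : set _) y.
Proof.
move=> xy; apply: subr0_eq; rewrite -[LHS]rmorphB; exact: quo_pi_eq0.
Qed.

Lemma tens_comm x y : tensl x * tensr y = tensr y * tensl x.
Proof. by rewrite -[LHS]rmorphM -[RHS]rmorphM; apply/rel_eq/tensor_comm. Qed.

Let tlD x x' : tensl (x + x') = tensl x + tensl x'.
Proof. by rewrite -[RHS]rmorphD; apply/rel_eq/tensor_addl. Qed.
Let tlM x x' : tensl (x * x') = tensl x * tensl x'.
Proof. by rewrite -[RHS]rmorphM; apply/rel_eq/tensor_mull. Qed.
Let tlscal a : tensl (scal a) = scal a.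
Proof. exact/rel_eq/tensor_scall. Qed.
Let tlstar x : tensl (star x) = star (tensl x).
Proof. by rewrite -[RHS]hom_star; apply/rel_eq/tensor_starl. Qed.
Let trD x x' : tensr (x + x') = tensr x + tensr x'.
Proof. by rewrite -[RHS]rmorphD; apply/rel_eq/tensor_addr. Qed.
Let trM x x' : tensr (x * x') = tensr x * tensr x'.
Proof. by rewrite -[RHS]rmorphM; apply/rel_eq/tensor_mulr. Qed.
Let trscal a : tensr (scal a) = scal a.
Proof. exact/rel_eq/tensor_scalr. Qed.
Let trstar x : tensr (star x) = star (tensr x).
Proof. by rewrite -[RHS]hom_star; apply/rel_eq/tensor_starr. Qed.

Let tl_nmod : nmod_morphism tensl.
Proof. by split=> //; rewrite -scal0 tlscal scal0. Qed.
Let tl_mon : monoid_morphism tensl.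
Proof. by split=> //; rewrite -scal1 tlscal scal1. Qed.
HB.instance Definition _ := GRing.isNmodMorphism.Build A tensor tensl tl_nmod.
HB.instance Definition _ := GRing.isMonoidMorphism.Build A tensor tensl tl_mon.
HB.instance Definition _ := isStarPreserving.Build C A tensor tensl tlscal tlstar.
Let tr_nmod : nmod_morphism tensr.
Proof. by split=> //; rewrite -scal0 trscal scal0. Qed.
Let tr_mon : monoid_morphism tensr.
Proof. by split=> //; rewrite -scal1 trscal scal1. Qed.
HB.instance Definition _ := GRing.isNmodMorphism.Build B tensor tensr tr_nmod.
HB.instance Definition _ := GRing.isMonoidMorphism.Build B tensor tensr tr_mon.
HB.instance Definition _ := isStarPreserving.Build C B tensor tensr trscal trstar.

Lemma tensor_lift_hom (D : starAlgType C) (f : {starhom A -> D})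
    (g : {starhom B -> D}) :
  (forall x y, f x * g y = g y * f x) ->
  exists2 h : {starhom tensor -> D},
    forall x, h (tensl x) = f x & forall y, h (tensr y) = g y.
Proof.
move=> fg.
have [h0 h0E] := free_lift_hom (fun z : A + B =>
  match z with inl x => f x | inr y => g y end).
have hA x : h0 (inA x) = f x by rewrite h0E.
have hB y : h0 (inB y) = g y by rewrite h0E.
have rel0 z : tensor_rel z -> h0 z = 0.
  by case=> *; rewrite rmorphB /= ?rmorphD ?rmorphM /= ?hom_scal ?hom_star
    ?hA ?hB ?rmorphD ?rmorphM ?hom_scal ?hom_star ?hA ?hB ?fg subrr.
have [h hE] := quo_lift_hom rel0.
by exists h => x; rewrite hE.
Qed.
End Tensor.
Arguments tensl {C A B} x.
Arguments tensr {C A B} y.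

Section MatrixQuantumGroups.
Variables (C : numClosedFieldType) (N : nat).

Record matrix_pair : Type :=
  MatrixPair { coord : starAlgType C; fund : 'M[coord]_N }.

Definition entries (A : Type) (u : 'M[A]_N) : set A :=
  [set x | exists i j, x = u i j].

Definition adjoint (A : starAlgType C) (u : 'M[A]_N) : 'M[A]_N :=
  \matrix_(i, j) star (u j i).

Definition unitary (A : starAlgType C) (u : 'M[A]_N) : Prop :=
  u *m adjoint u = 1%:M /\ adjoint u *m u = 1%:M.

(* Similarity is by an invertible scalar matrix. *)
Definition similar_to_unitary (A : starAlgType C) (u : 'M[A]_N) : Prop :=
  exists2 F : 'M[C]_N, F \in unitmx &
    unitary (map_mx (@scal C A) F *m u *m map_mx (@scal C A) (invmx F)).

Lemma orthogonal_similar (A : starAlgType C) (u : 'M[A]_N) :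
  (forall i j, star (u i j) = u i j) -> u *m u^T = 1%:M -> u^T *m u = 1%:M ->
  similar_to_unitary u /\ similar_to_unitary u^T.
Proof.
move=> us uuT uTu.
have adju : adjoint u = u^T by apply/matrixP => i j; rewrite !mxE us.
have adjuT : adjoint u^T = u by apply/matrixP => i j; rewrite !mxE us.
have s1 : map_mx (@scal C A) 1%:M = 1%:M :> 'M_N.
  by apply/matrixP => i j; rewrite !mxE; case: eqP; rewrite ?scal1 ?scal0.
split; exists 1%:M; rewrite ?unitmx1 // invmx1 s1 mul1mx mulmx1.
  by split; rewrite adju.
by split; rewrite adjuT.
Qed.

Definition is_cmqg (G : matrix_pair) : Prop :=
  [/\ generates (entries (fund G)),
      similar_to_unitary (fund G),
      similar_to_unitary (fund G)^T
    & exists Delta : {starhom coord G -> tensor (coord G) (coord G)},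
        forall i j, Delta (fund G i j) =
          \sum_k tensl (fund G i k) * tensr (fund G k j)].

Record cmqg : Type := Cmqg { cmqg_pair :> matrix_pair; cmqgP : is_cmqg cmqg_pair }.

(* H is a quantum subgroup of G. *)
Definition qsubgroup (H G : matrix_pair) : Prop :=
  exists2 f : {starhom coord G -> coord H},
    (forall y, exists x, f x = y) & forall i j, f (fund G i j) = fund H i j.

Definition identical (G H : matrix_pair) : Prop := qsubgroup G H /\ qsubgroup H G.

Definition proper_qsubgroup (H G : matrix_pair) : Prop :=
  qsubgroup H G /\ ~ identical H G.

(* The quotient of O(G) by the relations x = 0 for x in S. *)
Definition impose (G : matrix_pair) (S : set (coord G)) : matrix_pair :=
  @MatrixPair (quotient S) (map_mx (quo_pi S) (fund G)).

Definition commutation_rels (A : starAlgType C) (u : 'M[A]_N) : set A :=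
  [set x | exists i j k l, x = u i j * u k l - u k l * u i j].

Inductive anticommutation_rels (A : starAlgType C) (u : 'M[A]_N) : A -> Prop :=
| anticomm_col i j k : i != j ->
    anticommutation_rels u (u i k * u j k - - (u j k * u i k))
| anticomm_row i j k : i != j ->
    anticommutation_rels u (u k i * u k j - - (u k j * u k i))
| anticomm_comm i j k l : i != j -> k != l ->
    anticommutation_rels u (u i k * u j l - u j l * u i k).

(* O(G) is the star-algebra of functions on G generated by the coordinate   *)
(* functions.                                                               *)
Definition matrix_group (G : set 'M[C]_N) : matrix_pair :=
  let u i j : set_type G -> C := fun g => val g i j in
  let S := [set f | exists i j, f = u i j] in
  @MatrixPair (subalgebra S)
    (\matrix_(i, j) in_subalgebra (ex_intro _ i (ex_intro _ j erefl) : S (u i j))).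
End MatrixQuantumGroups.

Section LinearCategoryQuantumGroups.
Variables (C : numClosedFieldType) (N : nat).
Notation multi := (multi N).

Section Intertwiners.
Variables (A : starAlgType C) (u : 'M[A]_N).

Definition tpow k (i j : multi k) : A := \prod_(a < k) u (i a) (j a).

(* Entry (j, i) of T u^(x)k - u^(x)l T. *)
Definition mor_defect k l (T : multi l -> multi k -> C) (j : multi l)
    (i : multi k) : A :=
  \sum_(i' : multi k) scal (T j i') * tpow i' i
  - \sum_(j' : multi l) tpow j j' * scal (T j' i).

(* T belongs to Mor(u^(x)k, u^(x)l). *)
Definition Mor k l (T : multi l -> multi k -> C) : Prop :=
  forall j i, mor_defect T j i = 0.
End Intertwiners.

Lemma hom_tpow (A B : starAlgType C) (f : {starhom A -> B}) (u : 'M[A]_N) k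
    (i j : multi k) :
  f (tpow u i j) = tpow (map_mx f u) i j.
Proof. by rewrite rmorph_prod; apply: eq_bigr => a _; rewrite mxE. Qed.

Lemma hom_mor_defect (A B : starAlgType C) (f : {starhom A -> B}) (u : 'M[A]_N)
    k l (T : multi l -> multi k -> C) j i :
  f (mor_defect u T j i) = mor_defect (map_mx f u) T j i.
Proof.
rewrite rmorphB !rmorph_sum; congr (_ - _); apply: eq_bigr => x _;
  by rewrite rmorphM /= hom_scal hom_tpow.
Qed.

Lemma morE (A : starAlgType C) (u : 'M[A]_N) k l (T : multi l -> multi k -> C) :
  Mor u T -> forall j i, \sum_(i' : multi k) scal (T j i') * tpow u i' i
    = \sum_(j' : multi l) tpow u j j' * scal (T j' i).
Proof. by move=> uT j i; apply: subr0_eq; apply: uT. Qed.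

Variable K : forall k l, plin C k l -> Prop.

Inductive lincat_rels : free C ('I_N * 'I_N) -> Prop :=
| rel_selfadjoint i j : lincat_rels (star (gen C (i, j)) - gen C (i, j))
| rel_intertwiner k l (f : plin C k l) (j : multi l) (i : multi k) :
    K f -> lincat_rels
      (mor_defect (\matrix_(a, b) gen C (a, b)) (Tmap f) j i).

(* The universal star-algebra generated by self-adjoint u_ij subject to     *)
(* T_f u^(x)k = u^(x)l T_f for f in K(k, l).                                *)
Definition lincat_matrix_pair : matrix_pair C N :=
  let u : 'M[free C ('I_N * 'I_N)]_N := \matrix_(a, b) gen C (a, b) in
  @MatrixPair C N (quotient (lincat_rels : set _))
    (map_mx (quo_pi (lincat_rels : set _)) u).

Let O := coord lincat_matrix_pair.
Let u : 'M[O]_N := fund lincat_matrix_pair.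

Lemma lincat_star i j : star (u i j) = u i j.
Proof.
rewrite !mxE -hom_star; apply: subr0_eq; rewrite -[LHS]rmorphB.
exact/quo_pi_eq0/rel_selfadjoint.
Qed.

Lemma lincat_mor k l (f : plin C k l) : K f -> Mor u (Tmap f).
Proof.
by move=> Kf j i; rewrite -[LHS]hom_mor_defect; apply/quo_pi_eq0/rel_intertwiner.
Qed.

Lemma lincat_universal (B : starAlgType C) (v : 'M[B]_N) :
  (forall i j, star (v i j) = v i j) ->
  (forall k l (f : plin C k l), K f -> Mor v (Tmap f)) ->
  exists h : {starhom O -> B}, forall i j, h (u i j) = v i j.
Proof.
move=> vS vK; have [g gE] := @free_lift_hom C _ B (fun x => v x.1 x.2).
have gu : map_mx g (\matrix_(a, b) gen C (a, b)) = v.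
  by apply/matrixP => i j; rewrite !mxE gE.
have g0 x : (lincat_rels : set _) x -> g x = 0.
  case=> [i j|k l f j i Kf]; last by rewrite hom_mor_defect gu; apply: vK.
  by rewrite rmorphB /= hom_star gE vS subrr.
by have [h hE] := quo_lift_hom g0; exists h => i j; rewrite !mxE hE gE.
Qed.

Lemma lincat_generates : generates (entries u).
Proof.
apply/seteqP; split=> // q _ B BP uB.
have [x <-] := quo_surj q.
have : star_span (range (gen C (X:=('I_N * 'I_N)%type))) x.
  by rewrite (free_generated C _).
move/(_ [set y | B (quo_pi (lincat_rels : set _) y)]); apply.
  split=> [a|y z By Bz|y z By Bz|y By]; rewrite /mkset.
  - by rewrite hom_scal; apply: (subalg_scal BP).
  - by rewrite rmorphD; apply: (subalgD BP).
  - by rewrite rmorphM; apply: (subalgM BP).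
  - by rewrite hom_star; apply: (subalg_star BP).
by move=> _ [[i j] _ <-]; apply: uB; exists i, j; rewrite !mxE.
Qed.

Hypothesis KP : linear_category N K.

Let pairK : K (pbasis C (one_block 0 2)) := lincat_pair KP.
Let copairK : K (lin_flip (pbasis C (one_block 0 2))) := lincat_flip KP pairK.

Lemma lin_flip_basis k l (p : parts k l) :
  lin_flip (pbasis C p) = pbasis C (part_flip p).
Proof.
rewrite /lin_flip (bigD1 p) //= ffunE eqxx conjC1 scale1r big1 ?addr0 //.
by move=> q /negPf qp; rewrite ffunE qp conjC0 scale0r.
Qed.

Let pairE (j : multi 2) (i : multi 0) :
  Tmap (pbasis C (one_block 0 2)) j i = (j ord0 == j ord_max)%:R.
Proof.
rewrite Tmap_basis block_constant_merge; congr (_ %:R); congr nat_of_bool.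
apply/forallP/eqP => [/(_ (inr ord0))/forallP/(_ (inr ord_max))/eqP //|jj].
have jc (a b : 'I_2) : j a = j b.
  have E (c : 'I_2) : j c = j ord0.
    by case: c => [[|[|]]] // lt; [|rewrite jj]; congr (j _); apply: val_inj.
  by rewrite !E.
by case=> [[]//|a]; apply/forallP; case=> [[]//|b] /=; apply/eqP.
Qed.

Let copairE (j : multi 0) (i : multi 2) :
  Tmap (lin_flip (pbasis C (one_block 0 2))) j i = (i ord0 == i ord_max)%:R.
Proof.
rewrite lin_flip_basis Tmap_basis block_constant_merge.
congr (_ %:R); congr nat_of_bool; apply/forallP/eqP => [iP|ii].
  have /forallP/(_ (inl ord_max))/implyP := iP (inl ord0).
  move=> iP'; apply/eqP/iP'/existsP; exists (inr ord0).
  apply/existsP; exists (inr ord_max); rewrite !eqxx !andbT.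
  by rewrite /linked same_block_merge connect1.
have jc (a b : 'I_2) : i a = i b.
  have E (c : 'I_2) : i c = i ord0.
    by case: c => [[|[|]]] // lt; [|rewrite ii]; congr (i _); apply: val_inj.
  by rewrite !E.
case=> [a|[]//]; apply/forallP; case=> [b|[]//] /=; apply/implyP => _.
exact/eqP.
Qed.

Let tpow0 (i j : multi 0) : tpow u i j = 1.
Proof. exact: big_ord0. Qed.

Let multi2 (a b : 'I_N) : multi 2 := [ffun c : 'I_2 => if c == ord0 then a else b].

Let tpow2 (i j : multi 2) :
  tpow u i j = u (i ord0) (j ord0) * u (i ord_max) (j ord_max).
Proof.
rewrite /tpow big_ord_recl big_ord1; congr (_ * u (i _) (j _)); exact: val_inj.
Qed.

Let sum0 (F : multi 0 -> O) (z : multi 0) : \sum_j F j = F z.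
Proof.
rewrite (bigD1 z) //= big1 ?addr0 // => y /eqP[].
by apply/ffunP => -[].
Qed.

Let sum2 (F : multi 2 -> O) :
  (forall j : multi 2, j ord0 != j ord_max -> F j = 0) ->
  \sum_j F j = \sum_a F (multi2 a a).
Proof.
move=> F0; rewrite (bigID (fun j : multi 2 => j ord0 == j ord_max)) /=.
rewrite [X in _ + X]big1 // addr0.
rewrite (reindex_onto (fun a => multi2 a a) (fun j : multi 2 => j ord0)).
  by apply: eq_bigl => a; rewrite !ffunE /= !eqxx.
move=> j /eqP jj; apply/ffunP => c; rewrite ffunE.
by case: ifP => [/eqP->//|c0]; rewrite jj; congr (j _);
   apply: val_inj; case: c c0 => [[|[|]]].
Qed.

Let scalb (b : bool) : scal (b%:R : C) = b%:R :> O.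
Proof. by case: b; rewrite ?scal1 ?scal0. Qed.

Lemma lincat_uuT : u *m u^T = 1%:M.
Proof.
apply/matrixP => i j; rewrite !mxE.
have z : multi 0 := [ffun x : 'I_0 => i].
have := morE (lincat_mor pairK) (multi2 i j) z.
rewrite (sum0 _ z) tpow0 mulr1 pairE scalb !ffunE /= => ->.
rewrite sum2 => [|y /negPf y0]; last by rewrite pairE y0 scal0 mulr0.
apply: eq_bigr => a _; rewrite pairE !ffunE /= eqxx scal1 mulr1 tpow2 !ffunE /=.
by rewrite [u^T _ _]mxE.
Qed.

Lemma lincat_uTu : u^T *m u = 1%:M.
Proof.
apply/matrixP => i j; rewrite !mxE.
have z : multi 0 := [ffun x : 'I_0 => i].
have := morE (lincat_mor copairK) z (multi2 i j).
rewrite (sum0 _ z) tpow0 mul1r copairE scalb !ffunE /= => <-.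
rewrite sum2 => [|y /negPf y0]; last by rewrite copairE y0 scal0 mul0r.
apply: eq_bigr => a _; rewrite copairE !ffunE /= eqxx scal1 mul1r tpow2 !ffunE /=.
by rewrite [u^T _ _]mxE.
Qed.

Let T := tensor O O.
Let tl : {starhom O -> T} := @tensl C O O.
Let tr : {starhom O -> T} := @tensr C O O.
Let v : 'M[T]_N := \matrix_(i, j) \sum_k tl (u i k) * tr (u k j).

Let prod_tens k (a b : 'I_k -> O) :
  \prod_i (tl (a i) * tr (b i)) = tl (\prod_i a i) * tr (\prod_i b i).
Proof.
elim: k a b => [|k IHk] a b; first by rewrite !big_ord0 !rmorph1 mulr1.
rewrite !big_ord_recl IHk !rmorphM -!mulrA; congr (_ * _).
by rewrite !mulrA; congr (_ * _); apply/esym/tens_comm.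
Qed.

Let v_tpow k (i j : multi k) :
  tpow v i j = \sum_m tl (tpow u i m) * tr (tpow u m j).
Proof.
rewrite /tpow; under eq_bigr => a _ do rewrite mxE.
by rewrite bigA_distr_bigA; apply: eq_bigr => m _; rewrite prod_tens.
Qed.

Lemma lincat_comult : exists Delta : {starhom O -> tensor O O},
  forall i j, Delta (u i j) = \sum_k tensl (u i k) * tensr (u k j).
Proof.
have vS i j : star (v i j) = v i j.
  rewrite mxE star_sum; apply: eq_bigr => k _.
  by rewrite starM -!hom_star !lincat_star; apply/esym/tens_comm.
have vK k l (f : plin C k l) : K f -> Mor v (Tmap f).
  move=> Kf j i; apply/eqP; rewrite subr_eq0; apply/eqP.
  have uf := morE (lincat_mor Kf).
  transitivity (\sum_m tl (\sum_j' tpow u j j' * scal (Tmap f j' m)) * tr (tpow u m i)).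
    under [LHS]eq_bigr => i' _ do rewrite v_tpow mulr_sumr.
    rewrite exchange_big; apply: eq_bigr => m _; rewrite -uf rmorph_sum mulr_suml.
    by apply: eq_bigr => i' _; rewrite rmorphM /= hom_scal mulrA.
  under [RHS]eq_bigr => j' _ do rewrite v_tpow mulr_suml.
  rewrite [RHS]exchange_big /=.
  transitivity (\sum_j' tl (tpow u j j') * tr (\sum_m scal (Tmap f j' m) * tpow u m i)).
    under [LHS]eq_bigr => m _ do rewrite rmorph_sum mulr_suml.
    rewrite exchange_big; apply: eq_bigr => j' _; rewrite rmorph_sum mulr_sumr.
    by apply: eq_bigr => m _; rewrite !rmorphM /= !hom_scal mulrA.
  apply: eq_bigr => j' _; rewrite uf rmorph_sum mulr_sumr.
  by apply: eq_bigr => m _; rewrite rmorphM /= hom_scal mulrA.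
have [D DE] := lincat_universal vS vK.
by exists D => i j; rewrite DE mxE.
Qed.

Lemma lincat_cmqg : is_cmqg lincat_matrix_pair.
Proof.
have [su suT] := orthogonal_similar lincat_star lincat_uuT lincat_uTu.
split; [exact: lincat_generates|exact: su|exact: suT|].
exact: lincat_comult.
Qed.

Definition lincat_qg : cmqg C N := Cmqg lincat_cmqg.
End LinearCategoryQuantumGroups.

Section FiniteMatrixGroup.
Variables (C : numClosedFieldType) (N : nat) (G : set 'M[C]_N).
Variable s : seq (set_type G).
Hypothesis s_uniq : uniq s.
Hypothesis s_all : forall g, g \in s.
Hypothesis G_mul : forall x y, G x -> G y -> G (x *m y).
Hypothesis G_real : forall x i j, G x -> (x i j)^* = x i j.
Hypothesis G_orth : forall x, G x -> x *m x^T = 1%:M.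

Let O := coord (matrix_group G).
Let u : 'M[O]_N := fund (matrix_group G).
Let ev (g : set_type G) (x : O) : C := val x g.

Let ev_u g i j : ev g (u i j) = val g i j.
Proof. by rewrite /ev mxE. Qed.
Let evD g x y : ev g (x + y) = ev g x + ev g y. Proof. by []. Qed.
Let evM g x y : ev g (x * y) = ev g x * ev g y. Proof. by []. Qed.
Let ev_scal g a : ev g (scal a) = a. Proof. by []. Qed.
Let ev_star g x : ev g (star x) = (ev g x)^*. Proof. by []. Qed.
Let ev_prod g I (r : seq I) (F : I -> O) :
  ev g (\prod_(i <- r) F i) = \prod_(i <- r) ev g (F i).
Proof. by elim/big_rec2: _ => // i a x _ <-. Qed.
Let ev_sum g I (r : seq I) (F : I -> O) :
  ev g (\sum_(i <- r) F i) = \sum_(i <- r) ev g (F i).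
Proof. by elim/big_rec2: _ => // i a x _ <-. Qed.
Let ev_inj x y : (forall g, ev g x = ev g y) -> x = y.
Proof. by move=> xy; apply/val_inj/funext. Qed.

Let sepE (g h : set_type G) : g != h ->
  exists x : O, ev g x = 1 /\ ev h x = 0.
Proof.
move=> gh; have /existsP[i /existsP[j gh_ij]] :
    [exists i, exists j, val g i j != val h i j].
  apply: contraR gh; rewrite negb_exists => /forallP gh.
  apply/eqP/val_inj/matrixP => i j; have := gh i.
  by rewrite negb_exists => /forallP/(_ j); rewrite negbK => /eqP.
exists (scal (val g i j - val h i j)^-1 * (u i j + scal (- val h i j))).
rewrite !evM !evD !ev_scal !ev_u subrr mulr0; split=> //.
by rewrite mulVf // subr_eq0.
Qed.

Let deltaE (g : set_type G) : exists x : O, forall h, ev h x = (g == h)%:R.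
Proof.
have /choice[c cP] : forall h, exists x : O, g != h -> ev g x = 1 /\ ev h x = 0.
  move=> h; case: (eqVneq g h) => [->|gh]; first by exists 0.
  by have [x xP] := sepE gh; exists x.
exists (\prod_(h <- rem g s) c h) => h; rewrite ev_prod.
case: eqVneq => [<-|gh].
  rewrite big_seq big1 // => k; rewrite mem_rem_uniq // inE => /andP[kg _].
  by have [] := cP k _; rewrite 1?eq_sym.
have hs : h \in rem g s by rewrite mem_rem_uniq // inE s_all eq_sym gh.
by rewrite (big_rem h) //=; have [_ ->] := cP h gh; rewrite mul0r.
Qed.

Let sum_delta (D : nmodType) (F : set_type G -> D) h :
  (forall g, g != h -> F g = 0) -> \sum_(g <- s) F g = F h.
Proof.
move=> F0; rewrite (big_rem h) //= big_seq big1 ?addr0 // => g.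
by rewrite mem_rem_uniq // inE => /andP[/F0].
Qed.

Let mulG (g h : set_type G) : set_type G :=
  exist _ (val g *m val h) (mem_set (G_mul (set_mem (valP g)) (set_mem (valP h)))).

Lemma finite_matrix_group_comult : exists Delta : {starhom O -> tensor O O},
  forall i j, Delta (u i j) = \sum_k tensl (u i k) * tensr (u k j).
Proof.
have /choice[d dP] := deltaE.
have d_exp (x : O) : x = \sum_(g <- s) scal (ev g x) * d g.
  apply: ev_inj => h; rewrite ev_sum (sum_delta (h := h)).
    by rewrite evM ev_scal dP eqxx mulr1.
  by move=> g /negPf gh; rewrite evM dP gh mulr0.
have d_mul g h : d g * d h = if g == h then d g else 0.
  apply: ev_inj => k; rewrite evM !dP; case: (eqVneq g h) => [<-|gh].
    by rewrite dP; case: (g == k); rewrite ?mulr1 ?mulr0.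
  rewrite -natrM mulnb (_ : (g == k) && (h == k) = false) //.
  by apply: contraNF gh => /andP[/eqP-> /eqP->].
have d_star g : star (d g) = d g.
  by apply: ev_inj => k; rewrite ev_star !dP conjC_nat.
have d_one : \sum_(g <- s) d g = 1.
  apply: ev_inj => h; rewrite ev_sum (sum_delta (h := h)).
    by rewrite dP eqxx.
  by move=> g /negPf gh; rewrite dP gh.
pose T := tensor O O.
pose tl : {starhom O -> T} := @tensl C O O.
pose tr : {starhom O -> T} := @tensr C O O.
have tlr x y : tl x * tr y = tr y * tl x by apply: tens_comm.
pose D (x : O) : T :=
  \sum_(g <- s) \sum_(h <- s) scal (ev (mulG g h) x) * (tl (d g) * tr (d h)).
have DD x y : D (x + y) = D x + D y.
  rewrite /D -big_split; apply: eq_bigr => g _; rewrite -big_split.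
  by apply: eq_bigr => h _; rewrite evD scalD mulrDl.
have Dscal a : D (scal a) = scal a.
  rewrite -[RHS]mulr1 -(rmorph1 tl) -d_one rmorph_sum mulr_sumr.
  apply: eq_bigr => g _; rewrite -[X in _ = _ * X]mulr1 -(rmorph1 tr) -d_one.
  rewrite rmorph_sum !mulr_sumr; apply: eq_bigr => h _.
  by rewrite ev_scal.
have Dstar x : D (star x) = star (D x).
  rewrite /D star_sum; apply: eq_bigr => g _; rewrite star_sum.
  apply: eq_bigr => h _; rewrite ev_star !starM -!hom_star !d_star star_scal.
  by rewrite -tlr scalC.
have e_mul g h g' h' : tl (d g) * tr (d h) * (tl (d g') * tr (d h'))
    = if (g == g') && (h == h') then tl (d g) * tr (d h) else 0.
  rewrite mulrA -[X in X * _ = _]mulrA -tlr.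
  rewrite [LHS](_ : _ = tl (d g * d g') * tr (d h * d h')); last first.
    by rewrite !rmorphM !mulrA.
  by rewrite !d_mul; case: (g == g'); case: (h == h') => //=;
    rewrite ?(rmorph0 tl) ?(rmorph0 tr) ?mulr0 ?mul0r.
have es_mul a b g h g' h' :
    scal a * (tl (d g) * tr (d h)) * (scal b * (tl (d g') * tr (d h')))
    = if (g == g') && (h == h') then scal (a * b) * (tl (d g) * tr (d h)) else 0.
  transitivity (scal (a * b) * (tl (d g) * tr (d h) * (tl (d g') * tr (d h')))).
    rewrite scalM -[LHS]mulrA -[RHS]mulrA; congr (_ * _).
    by rewrite [LHS]mulrA [RHS]mulrA scalC.
  by rewrite e_mul; case: ifP => // _; rewrite mulr0.
have DM x y : D (x * y) = D x * D y.
  rewrite [in RHS]/D mulr_suml; apply: eq_bigr => g _.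
  rewrite mulr_suml; apply: eq_bigr => h _.
  rewrite mulr_sumr (sum_delta (h := g)) => [|g' g'g]; last first.
    by rewrite mulr_sumr big1 // => h' _; rewrite es_mul eq_sym (negPf g'g).
  rewrite mulr_sumr (sum_delta (h := h)) => [|h' h'h]; last first.
    by rewrite es_mul eqxx eq_sym (negPf h'h).
  by rewrite es_mul !eqxx evM.
have hN : nmod_morphism D by split=> //; rewrite -scal0 Dscal scal0.
have hM : monoid_morphism D by split=> //; rewrite -scal1 Dscal scal1.
pose h1 := GRing.isNmodMorphism.Build O T D hN.
pose h2 := GRing.isMonoidMorphism.Build O T D hM.
pose h3 := isStarPreserving.Build C O T D Dscal Dstar.
pose h : {starhom O -> T} := HB.pack D h1 h2 h3.
exists h => i j; rewrite -[LHS]/(D _) /D.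
have uuE k : tl (u i k) * tr (u k j) = \sum_(g <- s) \sum_(g' <- s)
    scal (val g i k * val g' k j) * (tl (d g) * tr (d g')).
  rewrite [u i k]d_exp [u k j]d_exp !rmorph_sum mulr_suml.
  apply: eq_bigr => g _; rewrite mulr_sumr; apply: eq_bigr => g' _.
  rewrite !rmorphM /= !hom_scal !ev_u scalM -[LHS]mulrA -[RHS]mulrA.
  by congr (_ * _); rewrite [LHS]mulrA [RHS]mulrA scalC.
transitivity (\sum_k tl (u i k) * tr (u k j)); last by [].
under [RHS]eq_bigr => k _ do rewrite uuE.
rewrite [RHS]exchange_big /=; apply: eq_bigr => g _.
rewrite [RHS]exchange_big /=; apply: eq_bigr => g' _.
rewrite -mulr_suml; congr (_ * _).
rewrite ev_u mxE; elim/big_rec2: _ => [|k a b _ <-]; first by rewrite scal0.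
by rewrite scalD.
Qed.

Lemma matrix_group_generates : generates (entries u).
Proof.
apply/seteqP; split=> // x _ B BP uB.
case: x => x xP; have := xP => /asboolP.
pose B' : set (set_type G -> C) := [set f | exists2 y : O, B y & val y = f].
have B'P : star_subalgebra B'.
  split=> [a|_ _ [y By <-] [z Bz <-]|_ _ [y By <-] [z Bz <-]|_ [y By <-]].
  - by exists (scal a) => //; apply: (subalg_scal BP).
  - by exists (y + z) => //; apply: (subalgD BP).
  - by exists (y * z) => //; apply: (subalgM BP).
  - by exists (star y) => //; apply: (subalg_star BP).
move/(_ B' B'P)=> [|y By yx]; last by rewrite (_ : exist _ x xP = y) //; apply: val_inj.
move=> _ [i [j ->]]; exists (u i j); first by apply: uB; exists i, j.
by rewrite mxE.
Qed.

Lemma finite_matrix_group_cmqg : is_cmqg (matrix_group G).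
Proof.
have us i j : star (u i j) = u i j.
  apply: ev_inj => g; rewrite ev_star !ev_u; apply: G_real.
  exact: set_mem (valP g).
have uuT : u *m u^T = 1%:M.
  apply/matrixP => i j; apply: ev_inj => g; rewrite mxE ev_sum.
  have /matrixP/(_ i j) := G_orth (set_mem (valP g)); rewrite mxE.
  under eq_bigr => k _ do rewrite mxE.
  under [in X in _ -> X]eq_bigr => k _ do rewrite evM [u^T _ _]mxE !ev_u.
  by move=> ->; rewrite !mxE; case: (i == j).
have uTu : u^T *m u = 1%:M.
  apply/matrixP => i j; apply: ev_inj => g; rewrite mxE ev_sum.
  have /mulmx1C/matrixP/(_ i j) := G_orth (set_mem (valP g)); rewrite mxE.
  under eq_bigr => k _ do rewrite mxE.
  under [in X in _ -> X]eq_bigr => k _ do rewrite evM [u^T _ _]mxE !ev_u.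
  by move=> ->; rewrite !mxE; case: (i == j).
have [su suT] := orthogonal_similar us uuT uTu.
split; [exact: matrix_group_generates|exact: su|exact: suT|].
exact: finite_matrix_group_comult.
Qed.
End FiniteMatrixGroup.

Section D4.
Variable C : numClosedFieldType.

Definition permanent (A : comPzRingType) n (X : 'M[A]_n) : A :=
  \sum_(s : 'S_n) \prod_i X i (s i).

Definition signed_perm_mx n (s : 'S_n) (e : {ffun 'I_n -> bool}) : 'M[C]_n :=
  \matrix_(i, j) ((-1) ^+ e i *+ (s i == j)).

Definition D4_set : set 'M[C]_4 :=
  [set X | (exists s e, X = signed_perm_mx s e) /\ permanent X = 1].

Lemma permanent_signed n (s : 'S_n) e :
  permanent (signed_perm_mx s e) = \prod_i (-1) ^+ e i.
Proof.
rewrite /permanent (bigD1 s) //= [X in _ + X]big1 ?addr0 => [|t ts].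
  by apply: eq_bigr => i _; rewrite mxE eqxx.
have [i ti] : exists i, s i != t i.
  apply/existsP; apply: contraR ts; rewrite negb_exists => /forallP st.
  by apply/eqP/permP => i; apply/esym/eqP; have := st i; rewrite negbK.
by rewrite (bigD1 i) //= mxE (negPf ti) mulr0n mul0r.
Qed.

Lemma signed_perm_mul n (s t : 'S_n) (e f : {ffun 'I_n -> bool}) :
  signed_perm_mx s e *m signed_perm_mx t f
  = signed_perm_mx (s * t)%g [ffun i => e i (+) f (s i)].
Proof.
apply/matrixP => i j; rewrite !mxE (bigD1 (s i)) //= big1 ?addr0 => [|k ks].
  by rewrite !mxE eqxx ffunE permM signr_addb mulrnAr mulr1n.
by rewrite !mxE eq_sym (negPf ks) mulr0n mul0r.
Qed.

Lemma D4_mul X Y : D4_set X -> D4_set Y -> D4_set (X *m Y).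
Proof.
move=> [[s [e ->]]] + [[t [f ->]]]; rewrite signed_perm_mul !permanent_signed.
move=> e1 f1; split; first by exists (s * t)%g, [ffun i => e i (+) f (s i)].
rewrite permanent_signed; under eq_bigr => i _ do rewrite ffunE signr_addb.
rewrite big_split /= e1 mul1r -[RHS]f1 (reindex_inj (h := (s^-1)%g)) /=.
  by apply: eq_bigr => i _; rewrite permKV.
exact: perm_inj.
Qed.

Lemma D4_real X i j : D4_set X -> (X i j)^* = X i j.
Proof.
by move=> [[s [e ->]] _]; rewrite mxE rmorphMn rmorphXn rmorphN rmorph1.
Qed.

Lemma D4_orth X : D4_set X -> X *m X^T = 1%:M.
Proof.
move=> [[s [e ->]] _]; apply/matrixP => i j; rewrite !mxE.
rewrite (bigD1 (s i)) //= big1 ?addr0 => [|k ks]; last first.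
  by rewrite !mxE eq_sym (negPf ks) mulr0n mul0r.
rewrite !mxE eqxx (inj_eq perm_inj) eq_sym; case: eqP => [->|_]; last by rewrite mulr0.
by rewrite !mulr1n -signr_addb addbb.
Qed.

Lemma D4_enum : exists2 s : seq (set_type D4_set), uniq s & forall g, g \in s.
Proof.
pose M := [seq signed_perm_mx p.1 p.2 | p : 'S_4 * {ffun 'I_4 -> bool}].
exists (undup (pmap insub M)); first exact: undup_uniq.
move=> g; rewrite mem_undup mem_pmap_sub; apply/mapP.
by have [[s [e gE]] _] := set_mem (valP g); exists (s, e); rewrite ?mem_enum.
Qed.

Lemma D4_cmqg : is_cmqg (matrix_group D4_set).
Proof.
have [s us sP] := D4_enum.
exact: (finite_matrix_group_cmqg us sP D4_mul D4_real D4_orth).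
Qed.

Definition D4 : cmqg C 4 := Cmqg D4_cmqg.

Definition lin_gen k l (f : plin C k l) : {kl : nat * nat & plin C kl.1 kl.2} :=
  existT (fun kl : nat * nat => plin C kl.1 kl.2) (k, l) f.

Definition H4plus : cmqg C 4 :=
  lincat_qg (lin_spanP 4 [:: lin_gen (b4 C)]).

Definition D4plus : cmqg C 4 :=
  lincat_qg (lin_spanP 4 [:: lin_gen (T4b4 C); lin_gen (b4 C)]).
End D4.

(* Main.v *)
From HB Require Import structures.
Require Import Defs.
From mathcomp Require Import all_boot all_order all_algebra.
From mathcomp Require Import fingroup perm.
From mathcomp Require Import complex.
From mathcomp Require Import boolp classical_sets functions reals.

Set Implicit Arguments.
Unset Strict Implicit.
Unset Printing Implicit Defensive.

Import Order.TTheory GRing.Theory Num.Theory.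
Local Open Scope ring_scope.

(** A quantum subgroup of the free orthogonal quantum group with prescribed
    partition intertwiners is a universal object: a matrix [v] with self-adjoint
    entries is the image of its fundamental representation as soon as [v]
    intertwines the generating partitions. This needs the intertwiners of an
    orthogonal matrix to be closed under the operations on partitions
    ([Mor_category]), which rests on the functoriality of [Tmap]; the delicate
    part is composition, where the factor counting removed components must
    match the number of labellings of the middle row ([sum_glue]). The
    consequence is [lin_span_universal].

    The relation of the block of four points makes the entries of a row or of a
    column multiply to zero and satisfy [x ^ 3 = x] (matrices called [cubic]
    below). The reflection [tau] turns the vector [sum_m e_m^4] into a vector
    whose coefficient at [(j_1, .., j_4)] depends only on the parities of the
    multiplicities of the values, and is nonzero when the [j_a] are distinct. A
    signed permutation matrix multiplies each coefficient by a sign, and these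
    signs are all 1 on the support exactly when the four signs of the matrix have
    product 1. So, among signed
    permutation matrices, those in [D4] are exactly the ones that fix the
    reflected vector ([signed_perm_T4b4]).

    Hence [D4] is contained in [D4plus], and the diagonal matrix with one entry
    -1 separates [D4plus] from [H4plus]. A magic unitary commutes with [tau], so
    the free symmetric quantum group lies in [D4plus]; a block diagonal magic
    unitary built from two noncommuting projections shows that [D4plus] is not
    classical.

    Conversely, let [v] be cubic, fix the reflected vector, and have commuting
    entries ([commuting_D4]). Products of the spectral projections of the
    [v i j] form a partition of unity indexed by matrices with one entry 1 or -1
    in each row. The column relations kill the pieces which are not signed
    permutation matrices, the reflected vector kills those of permanent -1, and
    evaluating functions on [D4] at the remaining ones gives the homomorphism
    sought. Anticommutation of two entries of one row or column says nothing new,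
    both products being zero already, so that the (-1)-commutation relations
    hold in [D4] and force all entries to commute. *)

(** * Block-constant labellings *)

Section BlockConstant.
Variables (U : finType) (I : finType).

Lemma block_constantP (P : {set {set U}}) (f : U -> I) :
  reflect (forall x y, same_block P x y -> f x = f y) (block_constant P f).
Proof.
apply: (iffP forallP) => [fP x y xy|fP x].
  by have /forallP/(_ y)/implyP/(_ xy)/eqP := fP x.
by apply/forallP => y; apply/implyP => /fP ->.
Qed.

Variable P : {set {set U}}.
Hypothesis PU : finset.partition P [set: U].

Lemma mem_own_block x : x \in finset.pblock P x.
Proof. by rewrite mem_pblock (cover_partition PU) inE. Qed.

Lemma own_block_mem x : finset.pblock P x \in P.
Proof. by apply: pblock_mem; rewrite (cover_partition PU) inE. Qed.

Lemma pblock_same x y : same_block P x y -> finset.pblock P x = finset.pblock P y.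
Proof. by move=> xy; apply/esym/same_pblock => //; have/and3P[] := PU. Qed.

Lemma own_blockE x B : B \in P -> x \in B -> finset.pblock P x = B.
Proof. by move=> BP xB; apply: def_pblock => //; have/and3P[] := PU. Qed.

(** Prescribing values on [D] determines the label of every block which meets
    [D], provided the prescription is consistent; each of the remaining blocks
    may be labelled freely. *)
Lemma card_block_constant_ext (D : {set U}) (z : U -> I) :
  #|[set F : {ffun U -> I} | block_constant P F & [forall x in D, F x == z x]]|
  = ([forall x in D, forall y in D, same_block P x y ==> (z x == z y)]
     * #|I| ^ #|[set B in P | [disjoint B & D]]|)%N.
Proof.
set R := finset (fun B => (B \in P) && [disjoint B & D]).
case: (boolP [forall x in D, _]) => [/forall_inP zP|/forall_inPn[x xD]]; last first.
  case/forall_inPn=> y yD; rewrite negb_imply => /andP[xy zxy].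
  rewrite mul0n; apply/eqP; rewrite cards_eq0; apply/eqP/setP => F.
  rewrite !inE; apply/negP => /andP[/block_constantP/(_ x y xy) Fxy /forall_inP FD].
  by case/eqP: zxy; rewrite -(eqP (FD x xD)) -(eqP (FD y yD)).
rewrite mul1n -(card_sig (mem R)) -card_ffun.
(* Outside R, a block B takes the value of z at a chosen point of B in D. *)
pose Phi (phi : {ffun {B | B \in mem R} -> I}) : {ffun U -> I} :=
  [ffun x => if insub (finset.pblock P x) is Some B then phi B
             else z (odflt x [pick y in D | y \in finset.pblock P x])].
have inh (B : {B | B \in mem R}) : exists x, x \in val B.
  apply/finset.set0Pn; have /and3P[_ _ P0] := PU; apply: contraNneq P0 => <-.
  by have := valP B; rewrite /= inE => /andP[].
have PhiR phi (B : {B | B \in mem R}) x : x \in val B -> Phi phi x = phi B.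
  move=> xB; rewrite ffunE; have := valP B; rewrite /= inE => /andP[BP _].
  by rewrite (own_blockE BP xB) valK.
have PhiD phi x : x \in D -> Phi phi x = z x.
  move=> xD; rewrite ffunE insubF; last first.
    rewrite /= inE own_block_mem /=; apply: contraTF xD => /disjointFr-> //.
    exact: mem_own_block.
  case: pickP => [y /andP[yD xy] | /(_ x)] /=; last by rewrite xD mem_own_block.
  by move/forall_inP: (zP x xD) => /(_ y yD)/implyP/(_ xy)/eqP.
have Phi_inj : injective Phi.
  move=> phi psi eq_phi; apply/ffunP => B.
  by have [x xB] := inh B; rewrite -(PhiR phi B x xB) eq_phi (PhiR psi B x xB).
rewrite -cardsT -(card_imset _ Phi_inj); apply: eq_card => F; rewrite inE.
apply/andP/imsetP => [[/block_constantP FP /forall_inP FD]|[phi _ ->]].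
  exists [ffun B => F (xchoose (inh B))] => //; apply/ffunP => x.
  rewrite ffunE; case: insubP => [B _ xB|].
    rewrite ffunE; apply: FP; rewrite /same_block -xB; exact: xchooseP (inh B).
  rewrite inE own_block_mem /= => xD; case: pickP => [y /andP[yD xy]|D0].
    by rewrite /= (FP _ _ xy); apply/eqP/FD.
  case/negP: xD; rewrite disjoint_subset; apply/fintype.subsetP => y xy; rewrite !inE.
  by apply/negP => yD; have := D0 y; rewrite yD xy.
split; last by apply/forall_inP => x xD; rewrite PhiD.
apply/block_constantP => x y xy; rewrite !ffunE (pblock_same xy).
case: insubP => //; rewrite inE own_block_mem /= => yD.
case: pickP => //= D0; case/negP: yD.
rewrite disjoint_subset; apply/fintype.subsetP => t xt; rewrite !inE.
by apply/negP => tD; have := D0 t; rewrite tD xt.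
Qed.
End BlockConstant.

Section PushRelations.
Variables (I T : finType).

Lemma eq_block_constant (P : {set {set T}}) (F G : T -> I) :
  F =1 G -> block_constant P F = block_constant P G.
Proof.
by move=> FG; apply/block_constantP/block_constantP => FP x y xy;
  have := FP x y xy; rewrite !FG.
Qed.

Lemma forall_push_rel (S : finType) (f : S -> T) (e : rel S) (F : T -> I) :
  (forall x y, push_rel f e x y -> F x = F y)
  <-> (forall x y, e x y -> F (f x) = F (f y)).
Proof.
split=> [FP x y xy|FP x y /existsP[x' /existsP[y' /and3P[xy /eqP<- /eqP<-]]]].
  by apply: FP; apply/existsP; exists x; apply/existsP; exists y; rewrite xy !eqxx.
exact: FP.
Qed.

Lemma block_constant_mergeP (e : rel T) (F : T -> I) :
  reflect (forall x y, e x y -> F x = F y) (block_constant (merge_set e) F).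
Proof.
rewrite block_constant_merge; apply: (iffP forallP) => [FP x y xy|FP x].
  by have /forallP/(_ y)/implyP/(_ xy)/eqP := FP x.
by apply/forallP => y; apply/implyP => /FP ->.
Qed.

Lemma block_constant_push (S : finType) (f : S -> T) (P : {set {set S}}) (F : T -> I) :
  block_constant (merge_set (push_rel f (same_block P))) F = block_constant P (F \o f).
Proof.
apply/block_constant_mergeP/block_constantP => FP; exact/(forall_push_rel f _ F).
Qed.

(** Both the tensor product and the gluing of partitions are generated by two
    pushed relations; this is the only property of them that the maps see. *)
Lemma block_constant_push2 (S1 S2 : finType) (f : S1 -> T) (g : S2 -> T) (P : {set {set S1}})
    (Q : {set {set S2}}) (F : T -> I) :
  block_constant (merge_set (fun x y => push_rel f (same_block P) x y
                                     || push_rel g (same_block Q) x y)) F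
  = block_constant P (F \o f) && block_constant Q (F \o g).
Proof.
rewrite -(block_constant_push f) -(block_constant_push g).
apply/block_constant_mergeP/andP => [FP|[fP gP] x y /orP[xy|xy]].
- by split; apply/block_constant_mergeP => x y xy; apply: FP; rewrite xy ?orbT.
- exact: (elimT (block_constant_mergeP _ _) fP).
- exact: (elimT (block_constant_mergeP _ _) gP).
Qed.
End PushRelations.

(** * The maps of linear combinations of partitions *)

Section MapCalculus.
Variables (C : numClosedFieldType) (N : nat).
Implicit Types k l m : nat.


Lemma Tmap_linear k l (a : C) (f g : plin C k l) (j : multi N l) (i : multi N k) :
  Tmap (a *: f + g) j i = a * Tmap f j i + Tmap g j i.
Proof.
rewrite /Tmap mulr_sumr -big_split; apply: eq_bigr => p _.
by rewrite !ffunE mulrDl mulrA.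
Qed.

Lemma Tmap0 k l (j : multi N l) (i : multi N k) : Tmap (0 : plin C k l) j i = 0.
Proof. by rewrite /Tmap big1 // => p _; rewrite ffunE mul0r. Qed.

Lemma Tmap_sum (I : finType) k l (F : I -> plin C k l) (j : multi N l) (i : multi N k) :
  Tmap (\sum_x F x) j i = \sum_x Tmap (F x) j i.
Proof.
apply: (big_morph (fun f => Tmap f j i)) => [f g|]; last exact: Tmap0.
by rewrite -[f]scale1r Tmap_linear scale1r mul1r.
Qed.

Lemma TmapZ k l (a : C) (f : plin C k l) (j : multi N l) (i : multi N k) :
  Tmap (a *: f) j i = a * Tmap f j i.
Proof. by rewrite -[a *: f]addr0 Tmap_linear Tmap0 addr0. Qed.

Lemma TmapB k l (a : C) (f g : plin C k l) (j : multi N l) (i : multi N k) :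
  Tmap (f - a *: g) j i = Tmap f j i - a * Tmap g j i.
Proof.
rewrite /Tmap mulr_sumr -sumrB; apply: eq_bigr => p _.
by rewrite !ffunE mulrBl mulrA.
Qed.

Definition mleft k k' (i : multi N (k + k')) : multi N k := [ffun a => i (lshift k' a)].
Definition mright k k' (i : multi N (k + k')) : multi N k' := [ffun a => i (rshift k a)].
Definition mcat k k' (i : multi N k) (i' : multi N k') : multi N (k + k') :=
  [ffun a => match fintype.split a with inl b => i b | inr b => i' b end].

Lemma mleft_cat k k' (i : multi N k) (i' : multi N k') : mleft (mcat i i') = i.
Proof. by apply/ffunP => a; rewrite !ffunE (unsplitK (inl a)). Qed.
Lemma mright_cat k k' (i : multi N k) (i' : multi N k') : mright (mcat i i') = i'.
Proof. by apply/ffunP => a; rewrite !ffunE (unsplitK (inr a)). Qed.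
Lemma mcatK k k' (i : multi N (k + k')) : mcat (mleft i) (mright i) = i.
Proof.
by apply/ffunP => a; rewrite ffunE -[in RHS](splitK a); case: fintype.split => b; rewrite ffunE.
Qed.

Lemma sum_mcat (V : nmodType) k k' (F : multi N (k + k') -> V) :
  \sum_i F i = \sum_i \sum_i' F (mcat i i').
Proof.
rewrite pair_big (reindex (fun x => mcat x.1 x.2)) //.
exists (fun i => (mleft i, mright i)) => [[i i'] _|i _] /=; last exact: mcatK.
by rewrite mleft_cat mright_cat.
Qed.

Lemma Tmap_tensor k l k' l' (f : plin C k l) (g : plin C k' l')
    (j : multi N (l + l')) (i : multi N (k + k')) :
  Tmap (lin_tensor f g) j i
  = Tmap f (mleft j) (mleft i) * Tmap g (mright j) (mright i).
Proof.
rewrite /lin_tensor Tmap_sum [in RHS]/Tmap mulr_suml; apply: eq_bigr => p _.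
rewrite Tmap_sum mulr_sumr; apply: eq_bigr => q _.
rewrite TmapZ Tmap_basis mulrACA; congr (_ * _).
rewrite -natrM mulnb; congr ((nat_of_bool _)%:R).
rewrite block_constant_push2; congr (_ && _); apply: eq_block_constant => -[] a /=;
  by rewrite ffunE.
Qed.

Lemma Tmap_flip k l (f : plin C k l) (j : multi N k) (i : multi N l) :
  Tmap (lin_flip f) j i = (Tmap f i j)^*.
Proof.
rewrite /lin_flip Tmap_sum [in RHS]/Tmap rmorph_sum; apply: eq_bigr => p _.
rewrite TmapZ Tmap_basis rmorphM rmorph_nat; congr (_ * (nat_of_bool _)%:R).
by rewrite block_constant_push; apply: eq_block_constant => -[].
Qed.

End MapCalculus.

(** * Composition and the count of loops *)

Section Composition.
Variables (C : numClosedFieldType) (n k l m : nat).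
Notation N := n.+1.

Definition labels3 (i : multi N k) (x : multi N l) (j : multi N m)
    (u : 'I_k + 'I_l + 'I_m) : 'I_N :=
  match u with
  | inl (inl a) => i a
  | inl (inr b) => x b
  | inr c => j c
  end.

Lemma block_constant_glue (q : parts l m) (p : parts k l) i x j :
  block_constant (Defs.glue q p) (labels3 i x j)
  = block_constant (val p) (labels i x) && block_constant (val q) (labels x j).
Proof.
by rewrite block_constant_push2; congr (_ && _); apply: eq_block_constant => -[].
Qed.

(** A labelling of the middle row is admissible for both diagrams when, together
    with the outer labels, it is constant on the components of the glued diagram.
    Such extensions exist when the outer labels fit the composite, and then the
    removed components are the only free choices. The dimension is nonzero so
    that a default label is at hand. *)
Lemma sum_glue (q : parts l m) (p : parts k l) (i : multi N k) (j : multi N m) :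
  (\sum_(x : multi N l) block_constant (val p) (labels i x)
                     * block_constant (val q) (labels x j)
   = N ^ loops q p * block_constant (val (part_comp q p)) (labels i j))%N.
Proof.
pose O := [set outer_point l z | z : 'I_k + 'I_m] : {set 'I_k + 'I_l + 'I_m}.
(* Only the values on the outer points matter. *)
pose z := labels3 i [ffun=> ord0] j.
have zE y : z (outer_point l y) = labels i j y by case: y.
have GP : finset.partition (Defs.glue q p) [set: 'I_k + 'I_l + 'I_m] by apply: merge_partition.
have := card_block_constant_ext GP O z.
have -> : [forall x in O, forall y in O, same_block (Defs.glue q p) x y ==> (z x == z y)]
    = block_constant (val (part_comp q p)) (labels i j).
  apply/forall_inP/block_constant_mergeP => [zP x y xy|ijP _ /imsetP[x _ ->]].
    rewrite -!zE; apply/eqP; have /forall_inP := zP _ (imset_f _ (erefl : x \in predT)).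
    by move/(_ _ (imset_f _ (erefl : y \in predT)))/implyP; apply.
  by apply/forall_inP => _ /imsetP[y _ ->]; apply/implyP => xy; rewrite !zE (ijP x y).
have -> : [set B in Defs.glue q p | [disjoint B & O]]
    = [set B in Defs.glue q p | [forall z, outer_point l z \notin B]].
  apply/setP => B; rewrite !inE; congr (_ && _).
  apply/idP/forallP => [BO y|BO].
    by apply: contraTN BO => yB; apply/pred0Pn; exists (outer_point l y); rewrite /= yB imset_f.
  apply/pred0P => u /=; apply/negbTE/negP => /andP[uB /imsetP[y _ uE]].
  by have := BO y; rewrite -uE uB.
rewrite card_ord mulnC => <-.
under eq_bigr => x _ do rewrite mulnb -block_constant_glue.
rewrite -big_mkcond sum1_card /=.
pose L (x : multi N l) : {ffun _ -> 'I_N} := [ffun u => labels3 i x j u].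
have Linj : injective L.
  by move=> x y /ffunP xy; apply/ffunP => a; have := xy (inl (inr a)); rewrite !ffunE.
rewrite -(card_imset _ Linj); apply: eq_card => F; rewrite inE.
apply/imsetP/andP => [[x xP ->]|[FP /forall_inP FO]].
  split; last by apply/forall_inP => _ /imsetP[y _ ->]; rewrite ffunE; case: y.
  have LE : L x =1 labels3 i x j by move=> u; rewrite ffunE.
  by move: xP; rewrite unfold_in (eq_block_constant _ LE).
pose x : multi N l := [ffun a => F (inl (inr a))].
have xE : F =1 labels3 i x j.
  move=> [[a|b]|c] /=; rewrite ?ffunE //.
    exact/eqP/(FO (outer_point l (inl a)))/imset_f.
  exact/eqP/(FO (outer_point l (inr c)))/imset_f.
exists x; last by apply/ffunP => u; rewrite xE ffunE.
by move: FP; rewrite (eq_block_constant _ xE).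
Qed.

Lemma Tmap_comp (g : plin C l m) (f : plin C k l) (j : multi N m) (i : multi N k) :
  Tmap (lin_comp N g f) j i = \sum_x Tmap g j x * Tmap f x i.
Proof.
rewrite /lin_comp Tmap_sum [in RHS]/Tmap.
under [RHS]eq_bigr => x _ do rewrite mulr_suml.
rewrite [RHS]exchange_big /=; apply: eq_bigr => q _; rewrite Tmap_sum.
under [RHS]eq_bigr => x _ do rewrite mulr_sumr.
rewrite [RHS]exchange_big /=; apply: eq_bigr => p _.
rewrite TmapZ Tmap_basis.
transitivity (g q * f p * (\sum_(x : multi N l) block_constant (val p) (labels i x)
                     * block_constant (val q) (labels x j))%N%:R).
  by rewrite sum_glue natrM natrX mulrA.
rewrite natr_sum mulr_sumr; apply: eq_bigr => x _.
by rewrite natrM [RHS]mulrACA; congr (_ * _); apply: mulrC.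
Qed.
End Composition.

(** * Intertwiner spaces of orthogonal matrices *)

Section BasicMaps.
Variables (C : numClosedFieldType) (N : nat).

Lemma Tmap_one_block k l (j : multi N l) (i : multi N k) :
  Tmap (pbasis C (one_block k l)) j i
  = [forall x, forall y, labels i j x == labels i j y]%:R.
Proof. by rewrite Tmap_basis block_constant_merge. Qed.

Lemma Tmap_singletons k l (j : multi N l) (i : multi N k) :
  Tmap (pbasis C (singletons k l)) j i = 1.
Proof.
by rewrite Tmap_basis (introT (block_constant_mergeP _ _)).
Qed.

Lemma Tmap_id (j i : multi N 1) :
  Tmap (pbasis C (one_block 1 1)) j i = (j ord0 == i ord0)%:R.
Proof.
rewrite Tmap_one_block; congr (nat_of_bool _)%:R.
apply/forallP/eqP => [/(_ (inr ord0))/forallP/(_ (inl ord0))/eqP//|ji].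
by move=> [x|x]; apply/forallP => -[y|y] /=; rewrite !ord1 ?ji.
Qed.

Lemma Tmap_pair (j : multi N 2) (i : multi N 0) :
  Tmap (pbasis C (one_block 0 2)) j i = (j ord0 == j ord_max)%:R.
Proof.
rewrite Tmap_one_block; congr (nat_of_bool _)%:R.
apply/forallP/eqP => [/(_ (inr ord0))/forallP/(_ (inr ord_max))/eqP//|j01].
have jE (c : 'I_2) : j c = j ord0.
  by case: c => [[|[|]]] // lt; [|rewrite j01]; congr (j _); apply: val_inj.
by move=> [[]//|x]; apply/forallP => -[[]//|y] /=; rewrite !jE.
Qed.

Lemma sum_multi0 (V : nmodType) (F : multi N 0 -> V) z : \sum_x F x = F z.
Proof. by rewrite (bigD1 z) //= big1 ?addr0 // => y /eqP[]; apply/ffunP => -[]. Qed.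

Lemma sum_multi1 (V : nmodType) (F : multi N 1 -> V) :
  \sum_x F x = \sum_a F [ffun=> a].
Proof.
rewrite (reindex (fun a => [ffun=> a] : multi N 1)) //.
exists (fun x : multi N 1 => x ord0 : 'I_N) => [a _|x _]; first by rewrite ffunE.
by apply/ffunP => a; rewrite ffunE (ord1 a).
Qed.

End BasicMaps.

Lemma scal_nat (C : numClosedFieldType) (A : starAlgType C) (m : nat) :
  scal (m%:R : C) = m%:R :> A.
Proof. by elim: m => [|m IHm]; rewrite ?scal0 // !mulrS scalD scal1 IHm. Qed.

Lemma scal_sum (C : numClosedFieldType) (A : starAlgType C) I (r : seq I) (P : pred I)
    (F : I -> C) :
  scal (\sum_(i <- r | P i) F i) = \sum_(i <- r | P i) scal (F i) :> A.
Proof. exact: (big_morph _ (@scalD C A) (@scal0 C A)). Qed.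

Section Orthogonal.
Variables (C : numClosedFieldType) (A : starAlgType C) (n : nat).
Notation N := n.+1.
Variable v : 'M[A]_N.

Lemma tpow_cat k k' (i j : multi N (k + k')) :
  tpow v i j = tpow v (mleft i) (mleft j) * tpow v (mright i) (mright j).
Proof.
by rewrite /tpow big_split_ord; congr (_ * _); apply: eq_bigr => a _; rewrite !ffunE.
Qed.

Lemma tpow0 (i j : multi N 0) : tpow v i j = 1.
Proof. exact: big_ord0. Qed.

Lemma tpow1 (i j : multi N 1) : tpow v i j = v (i ord0) (j ord0).
Proof. exact: big_ord1. Qed.

Lemma MorP k l (T : multi N l -> multi N k -> C) :
  Mor v T <-> forall j i, \sum_(i' : multi N k) scal (T j i') * tpow v i' i
    = \sum_(j' : multi N l) tpow v j j' * scal (T j' i).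
Proof.
split=> [vT|vT j i]; first exact: morE.
by rewrite /mor_defect vT subrr.
Qed.

Lemma Mor_comp k l m (S : multi N m -> multi N l -> C) (T : multi N l -> multi N k -> C) :
  Mor v S -> Mor v T -> Mor v (fun j i => \sum_x S j x * T x i).
Proof.
move=> /MorP vS /MorP vT; apply/MorP => j i.
transitivity (\sum_x \sum_i' scal (S j x) * (scal (T x i') * tpow v i' i)).
  rewrite exchange_big; apply: eq_bigr => i' _; rewrite scal_sum mulr_suml.
  by apply: eq_bigr => x _; rewrite scalM mulrA.
transitivity (\sum_x \sum_j' tpow v j j' * (scal (S j' x) * scal (T x i))); last first.
  rewrite exchange_big; apply: eq_bigr => j' _; rewrite scal_sum mulr_sumr.
  by apply: eq_bigr => x _; rewrite scalM.
under eq_bigr => x _ do rewrite -mulr_sumr vT mulr_sumr.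
rewrite exchange_big [RHS](eq_bigr
  (fun x => (\sum_j' tpow v j j' * scal (S j' x)) * scal (T x i))).
  rewrite /=; apply: eq_bigr => x _; rewrite -vS mulr_suml.
  by apply: eq_bigr => y _; rewrite -!mulrA.
by move=> x _; rewrite mulr_suml; apply: eq_bigr => j' _; rewrite mulrA.
Qed.

Lemma Mor_tensor k l k' l' (S : multi N l -> multi N k -> C)
    (T : multi N l' -> multi N k' -> C) :
  Mor v S -> Mor v T ->
  Mor v (fun (j : multi N (l + l')) (i : multi N (k + k')) =>
           S (mleft j) (mleft i) * T (mright j) (mright i)).
Proof.
move=> /MorP vS /MorP vT; apply/MorP => j i; rewrite !sum_mcat.
transitivity ((\sum_x scal (S (mleft j) x) * tpow v x (mleft i)) *
              (\sum_y scal (T (mright j) y) * tpow v y (mright i))).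
  rewrite mulr_suml; apply: eq_bigr => x _; rewrite mulr_sumr; apply: eq_bigr => y _.
  rewrite tpow_cat !mleft_cat !mright_cat scalM -!mulrA; congr (_ * _).
  by rewrite !mulrA scalC.
rewrite vS vT mulr_suml; apply: eq_bigr => x _; rewrite mulr_sumr; apply: eq_bigr => y _.
rewrite tpow_cat !mleft_cat !mright_cat scalM -!mulrA; congr (_ * _).
by rewrite !mulrA; congr (_ * _); rewrite scalC.
Qed.

Hypothesis v_sa : forall i j, star (v i j) = v i j.
Hypothesis vvT : v *m v^T = 1%:M.
Hypothesis vTv : v^T *m v = 1%:M.

Lemma row_orthonormal i j : \sum_a v i a * v j a = (i == j)%:R.
Proof.
move/matrixP/(_ i j): vvT; rewrite !mxE => <-.
by apply: eq_bigr => a _; rewrite [v^T _ _]mxE.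
Qed.

Lemma col_orthonormal i j : \sum_a v a i * v a j = (i == j)%:R.
Proof.
move/matrixP/(_ i j): vTv; rewrite !mxE => <-.
by apply: eq_bigr => a _; rewrite [v^T _ _]mxE.
Qed.

Lemma eq_mcat k k' (i j : multi N (k + k')) :
  (i == j) = (mleft i == mleft j) && (mright i == mright j).
Proof.
by apply/eqP/andP => [->//|[/eqP l /eqP r]]; rewrite -(mcatK i) l r mcatK.
Qed.

Lemma eq_multi1 (i j : multi N 1) : (i == j) = (i ord0 == j ord0).
Proof. by apply/eqP/eqP => [->//|ij]; apply/ffunP => a; rewrite (ord1 a). Qed.

(** Tensor powers of an orthogonal matrix are unitary. As the entries need not
    commute, the inverse is the adjoint, whose entries are the products in
    reversed order, and not a tensor power of the transpose. *)
Lemma tpow_unitaryr k (i j : multi N k) :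
  \sum_m tpow v i m * star (tpow v j m) = (i == j)%:R.
Proof.
elim: k i j => [|k IHk]; last rewrite -[k.+1]add1n; move=> i j.
  rewrite (sum_multi0 _ i) !tpow0 star1 mulr1 (_ : i = j) ?eqxx //.
  by apply/ffunP => -[].
rewrite sum_mcat eq_mcat.
transitivity (\sum_a tpow v (mleft i) a * (mright i == mright j)%:R
                * star (tpow v (mleft j) a)).
  apply: eq_bigr => a _; rewrite -IHk mulr_sumr mulr_suml; apply: eq_bigr => b _.
  by rewrite !tpow_cat !mleft_cat !mright_cat starM !mulrA.
rewrite sum_multi1; case: (mright i == _); last first.
  by rewrite andbF big1 // => a _; rewrite mulr0 mul0r.
rewrite andbT eq_multi1 -row_orthonormal; apply: eq_bigr => a _.
by rewrite mulr1 !tpow1 v_sa ffunE.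
Qed.

Lemma tpow_unitaryl k (i j : multi N k) :
  \sum_m star (tpow v m i) * tpow v m j = (i == j)%:R.
Proof.
elim: k i j => [|k IHk]; last rewrite -[k.+1]add1n; move=> i j.
  rewrite (sum_multi0 _ i) !tpow0 star1 mulr1 (_ : i = j) ?eqxx //.
  by apply/ffunP => -[].
rewrite sum_mcat eq_mcat exchange_big /=.
transitivity (\sum_b star (tpow v b (mright i)) * (mleft i == mleft j)%:R
                * tpow v b (mright j)).
  apply: eq_bigr => b _; rewrite eq_multi1 -col_orthonormal sum_multi1.
  rewrite mulr_sumr mulr_suml; apply: eq_bigr => a _.
  rewrite !tpow_cat !mleft_cat !mright_cat starM !mulrA !tpow1 v_sa ffunE.
  by [].
case: (mleft i == _); last by rewrite big1 // => a _; rewrite mulr0 mul0r.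
by rewrite -IHk; apply: eq_bigr => a _; rewrite mulr1.
Qed.

(** Taking adjoints in [T u = u T] gives [u^* T^* = T^* u^*], and unitarity of
    the tensor powers allows multiplying by [u] on both sides. *)
Lemma Mor_adjoint k l (T : multi N l -> multi N k -> C) :
  Mor v T -> Mor v (fun i j => (T j i)^*).
Proof.
move=> /MorP vT; apply/MorP => i j.
have vTs i' m : \sum_i'' star (tpow v i'' i') * scal (T m i'')^*
    = \sum_j'' scal (T j'' i')^* * star (tpow v m j'').
  have := congr1 (@star C A) (vT m i'); rewrite !star_sum.
  by under eq_bigr do rewrite starM star_scal;
     under [X in _ = X -> _]eq_bigr do rewrite starM star_scal.
transitivity (\sum_i' \sum_m \sum_i''
    tpow v i i' * (star (tpow v i'' i') * scal (T m i'')^* * tpow v m j)).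
  rewrite exchange_big; apply: eq_bigr => m _; rewrite exchange_big /=.
  transitivity (\sum_i'' (i == i'')%:R * (scal (T m i'')^* * tpow v m j)).
    by rewrite (bigD1 i) //= eqxx mul1r big1 ?addr0 // => i''; rewrite eq_sym => /negPf->;
      rewrite mul0r.
  apply: eq_bigr => i'' _; rewrite -tpow_unitaryr mulr_suml.
  by apply: eq_bigr => i' _; rewrite !mulrA.
apply: eq_bigr => i' _.
under eq_bigr => m _ do rewrite -mulr_sumr -mulr_suml vTs.
rewrite -mulr_sumr; congr (_ * _).
transitivity (\sum_j'' scal (T j'' i')^* * (j'' == j)%:R : A).
  under [RHS]eq_bigr => j'' _ do rewrite -tpow_unitaryl mulr_sumr.
  rewrite exchange_big; apply: eq_bigr => m _; rewrite mulr_suml.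
  by apply: eq_bigr => j'' _; rewrite !mulrA.
rewrite (bigD1 j) //= eqxx mulr1 big1 ?addr0 // => j'' /negPf->.
by rewrite mulr0.
Qed.

Lemma Mor_id : Mor v (Tmap (pbasis C (one_block 1 1))).
Proof.
apply/MorP => j i; rewrite !sum_multi1 (bigD1 (j ord0)) //=.
rewrite Tmap_id ffunE eqxx scal1 mul1r big1 => [|a aj]; last first.
  by rewrite Tmap_id ffunE eq_sym (negPf aj) scal0 mul0r.
rewrite (bigD1 (i ord0)) //= Tmap_id ffunE eqxx scal1 mulr1 big1 => [|a ai].
  by rewrite !tpow1 !ffunE.
by rewrite Tmap_id ffunE (negPf ai) scal0 mulr0.
Qed.

Lemma Mor_pair : Mor v (Tmap (pbasis C (one_block 0 2))).
Proof.
apply/MorP => j i; rewrite (sum_multi0 _ i) tpow0 mulr1 Tmap_pair scal_nat.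
rewrite -row_orthonormal (@sum_mcat N _ 1 1) sum_multi1; apply: eq_bigr => a _.
have pairE b : Tmap (pbasis C (one_block 0 2)) (mcat (k := 1) [ffun=> a] [ffun=> b]) i
      = (a == b)%:R.
  rewrite Tmap_pair !ffunE.
  case: fintype.splitP => // x; rewrite ord1 ffunE => _.
  by case: fintype.splitP => y; rewrite ord1 ?ffunE.
rewrite sum_multi1 (bigD1 a) //= pairE eqxx scal1 mulr1 big1 ?addr0 => [|b ba].
  rewrite (@tpow_cat 1 1) mleft_cat mright_cat !tpow1 !ffunE.
  by congr (v (j _) _ * v (j _) _); apply: val_inj.
by rewrite pairE eq_sym (negPf ba) scal0 mulr0.
Qed.

Lemma Mor_category : linear_category N (fun k l f => Mor v (Tmap f)).
Proof.
split=> [k l|k l a f g /MorP vf /MorP vg|k l k' l' f g vf vg|k l m g f vg vf|k l f vf||].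
- apply/MorP => j i; rewrite !big1 // => x _; rewrite Tmap0 scal0 ?mul0r ?mulr0 //.
- apply/MorP => j i.
  transitivity (scal a * (\sum_i' scal (Tmap f j i') * tpow v i' i)
                + \sum_i' scal (Tmap g j i') * tpow v i' i).
    rewrite mulr_sumr -big_split; apply: eq_bigr => i' _.
    by rewrite Tmap_linear scalD scalM mulrDl mulrA.
  rewrite vf vg mulr_sumr -big_split; apply: eq_bigr => j' _.
  by rewrite Tmap_linear scalD scalM mulrDr !mulrA scalC.
- have := Mor_tensor vf vg; congr (Mor v _).
  by apply/funext => j; apply/funext => i; rewrite Tmap_tensor.
- have := Mor_comp vg vf; congr (Mor v _).
  by apply/funext => j; apply/funext => i; rewrite Tmap_comp.
- have := Mor_adjoint vf; congr (Mor v _).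
  by apply/funext => j; apply/funext => i; rewrite Tmap_flip.
- exact: Mor_id.
- exact: Mor_pair.
Qed.

(** It suffices to test the generators, because the intertwiners of [v] form a
    linear category of partitions. *)
Lemma lin_span_universal (s : seq {kl : nat * nat & plin C kl.1 kl.2}) :
  (forall g, List.In g s -> Mor v (Tmap (tagged g))) ->
  exists h : {starhom Defs.coord (lincat_matrix_pair N (lin_span N s)) -> A},
    forall i j, h (fund (lincat_matrix_pair N (lin_span N s)) i j) = v i j.
Proof.
move=> vs; apply: lincat_universal => // k l f Kf.
exact: (Kf _ Mor_category vs).
Qed.
End Orthogonal.

(** * The hyperoctahedral relations *)

(** The scalars as a star-algebra: points of a matrix group become
    homomorphisms into it. *)
Section Scalars.
Variable C : numClosedFieldType.
Let oscal (a : C) : C^o := a.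
Let ostar (x : C^o) : C^o := (x : C)^*.
Let oscal1 : oscal 1 = 1. Proof. by []. Qed.
Let oscalD a b : oscal (a + b) = oscal a + oscal b. Proof. by []. Qed.
Let oscalM a b : oscal (a * b) = oscal a * oscal b. Proof. by []. Qed.
Let oscalC a x : oscal a * x = x * oscal a. Proof. exact: (@mulrC C). Qed.
Let ostarK : involutive ostar. Proof. exact: conjCK. Qed.
Let ostarD x y : ostar (x + y) = ostar x + ostar y. Proof. exact: rmorphD. Qed.
Let ostarM x y : ostar (x * y) = ostar y * ostar x.
Proof. by rewrite [RHS](@mulrC C); apply: rmorphM. Qed.
Let ostar_scal a : ostar (oscal a) = oscal a^*. Proof. by []. Qed.
HB.instance Definition _ := isStarAlgebra.Build C C^o
  oscal1 oscalD oscalM oscalC ostarK ostarD ostarM ostar_scal.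
End Scalars.

Section StarHomomorphisms.
Variables (C : numClosedFieldType) (A B : starAlgType C) (f : {starhom A -> B}).

Lemma hom_Mor N (u : 'M[A]_N) k l (T : multi N l -> multi N k -> C) :
  Mor u T -> Mor (map_mx f u) T.
Proof. by move=> uT j i; rewrite -hom_mor_defect uT rmorph0. Qed.

Lemma generates_surj (T : set B) :
  generates T -> (forall y, T y -> exists x, f x = y) -> forall y, exists x, f x = y.
Proof.
move=> gT TS y; have : star_span T y by rewrite gT.
move/(_ (fun y => exists x, f x = y)); apply=> //.
split=> [a|_ _ [x <-] [x' <-]|_ _ [x <-] [x' <-]|_ [x <-]].
- by exists (scal a); rewrite hom_scal.
- by exists (x + x'); rewrite rmorphD.
- by exists (x * x'); rewrite rmorphM.
- by exists (star x); rewrite hom_star.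
Qed.
End StarHomomorphisms.

Section CubicMatrices.
Variable C : numClosedFieldType.

Record cubic (A : starAlgType C) (v : 'M[A]_4) : Prop := {
  cubic_sa : forall i j, star (v i j) = v i j;
  cubic_vvT : v *m v^T = 1%:M;
  cubic_vTv : v^T *m v = 1%:M;
  cubic_b4 : Mor v (Tmap (b4 C))
}.

Lemma hom_cubic (A B : starAlgType C) (f : {starhom A -> B}) (v : 'M[A]_4) :
  cubic v -> cubic (map_mx f v).
Proof.
move=> [sa vvT vTv vb]; split=> [i j|||]; last exact: hom_Mor.
- by rewrite mxE -hom_star sa.
- by rewrite map_trmx -map_mxM vvT map_mx1.
- by rewrite map_trmx -map_mxM vTv map_mx1.
Qed.

Section Separated.
Variables (I : Type) (A B : starAlgType C) (f : I -> {starhom A -> B}).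
Hypothesis f_sep : forall x, (forall i, f i x = 0) -> x = 0.

Lemma separated_eq x y : (forall i, f i x = f i y) -> x = y.
Proof. by move=> fxy; apply: subr0_eq; apply: f_sep => i; rewrite rmorphB /= fxy subrr. Qed.

Lemma separated_Mor (v : 'M[A]_4) k l (T : multi 4 l -> multi 4 k -> C) :
  (forall i, Mor (map_mx (f i) v) T) -> Mor v T.
Proof. by move=> vT y x; apply: f_sep => i; rewrite hom_mor_defect vT. Qed.

Lemma separated_cubic (v : 'M[A]_4) : (forall i, cubic (map_mx (f i) v)) -> cubic v.
Proof.
move=> fv; split=> [a b|||].
- by apply: separated_eq => i; have := cubic_sa (fv i) a b; rewrite mxE -hom_star.
- apply/matrixP => a b; apply: separated_eq => i.
  have := cubic_vvT (fv i); rewrite map_trmx -map_mxM -(map_mx1 (f i)).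
  by move=> /matrixP/(_ a b); rewrite !mxE.
- apply/matrixP => a b; apply: separated_eq => i.
  have := cubic_vTv (fv i); rewrite map_trmx -map_mxM -(map_mx1 (f i)).
  by move=> /matrixP/(_ a b); rewrite !mxE.
- by apply: separated_Mor => i; apply: cubic_b4 (fv i).
Qed.
End Separated.

Lemma D4plus_cubic : cubic (fund (D4plus C)).
Proof.
have KP := lin_spanP (C := C) 4 [:: lin_gen (T4b4 C); lin_gen (b4 C)].
split; [exact: lincat_star|exact: (lincat_uuT KP)|exact: (lincat_uTu KP)|].
by apply: lincat_mor => K _ /(_ (lin_gen (b4 C))); apply; right; left.
Qed.

Lemma D4plus_T4b4 : Mor (fund (D4plus C)) (Tmap (T4b4 C)).
Proof. by apply: lincat_mor => K _ /(_ (lin_gen (T4b4 C))); apply; left. Qed.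

Lemma H4plus_universal (A : starAlgType C) (v : 'M[A]_4) :
  cubic v ->
  exists h : {starhom Defs.coord (H4plus C) -> A}, forall i j, h (fund (H4plus C) i j) = v i j.
Proof.
move=> [sa vvT vTv vb]; apply: lin_span_universal => // g [<-|[]].
exact: vb.
Qed.

Lemma D4plus_universal (A : starAlgType C) (v : 'M[A]_4) :
  cubic v -> Mor v (Tmap (T4b4 C)) ->
  exists h : {starhom Defs.coord (D4plus C) -> A}, forall i j, h (fund (D4plus C) i j) = v i j.
Proof.
by move=> [sa vvT vTv vb] vT; apply: lin_span_universal => // g [<-|[<-|[]]].
Qed.

Lemma Mor_vector (A : starAlgType C) (v : 'M[A]_4) l (T : multi 4 l -> multi 4 0 -> C) :
  Mor v T <-> forall j i, \sum_j' tpow v j j' * scal (T j' i) = scal (T j i).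
Proof.
rewrite MorP; split=> vT j i.
  by rewrite -vT (sum_multi0 _ i) tpow0 mulr1.
by rewrite vT (sum_multi0 _ i) tpow0 mulr1.
Qed.

Definition quad (i j k l : 'I_4) : multi 4 4 := [ffun a => tnth [tuple i; j; k; l] a].

Lemma tpow_quad (A : starAlgType C) (v : 'M[A]_4) i j k l i' j' k' l' :
  tpow v (quad i j k l) (quad i' j' k' l') = v i i' * v j j' * v k k' * v l l'.
Proof.
by rewrite /tpow !big_ord_recl big_ord0 mulr1 !ffunE !mulrA.
Qed.

Lemma sum_constant (V : nmodType) (F : multi 4 4 -> V) :
  (forall x : multi 4 4, ~~ [forall a, x a == x ord0] -> F x = 0) ->
  \sum_x F x = \sum_m F (quad m m m m).
Proof.
move=> F0; have qE m (a : 'I_4) : quad m m m m a = m.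
  by rewrite ffunE; case: a => [[|[|[|[|]]]]].
rewrite (bigID (fun x : multi 4 4 => [forall a, x a == x ord0])) /=.
rewrite [X in _ + X]big1 // addr0.
rewrite (reindex_onto (fun m => quad m m m m) (fun x : multi 4 4 => x ord0)) /=.
  by apply: eq_bigl => m; rewrite qE eqxx andbT; apply/forallP => a; rewrite !qE.
by move=> x /forallP xP; apply/ffunP => a; rewrite qE (eqP (xP a)).
Qed.

Lemma Tmap_b4 (j : multi 4 4) (i : multi 4 0) :
  Tmap (b4 C) j i = [forall a, j a == j ord0]%:R.
Proof.
rewrite Tmap_one_block; congr (nat_of_bool _)%:R.
apply/forallP/forallP => [ij a|jE].
  by have /forallP/(_ (inr ord0)) := ij (inr a).
move=> [[]//|a]; apply/forallP => -[[]//|b] /=.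
by rewrite (eqP (jE a)) (eqP (jE b)).
Qed.

Definition quartic (A : starAlgType C) (v : 'M[A]_4) : Prop :=
  forall i j k l, \sum_m v i m * v j m * v k m * v l m
    = ([&& j == i, k == i & l == i])%:R.

Lemma constant_quad i j k l :
  [forall a, quad i j k l a == quad i j k l ord0] = [&& j == i, k == i & l == i].
Proof.
apply/forallP/and3P => [q|[/eqP ji /eqP ki /eqP li] a].
  have := (q (@Ordinal 4 1 isT), q (@Ordinal 4 2 isT), q (@Ordinal 4 3 isT)).
  by rewrite !ffunE => -[[]].
by rewrite !ffunE ji ki li; case: a => [[|[|[|[|]]]]].
Qed.

Lemma Mor_b4_quartic (A : starAlgType C) (v : 'M[A]_4) :
  Mor v (Tmap (b4 C)) <-> quartic v.
Proof.
have quadE (j : multi 4 4) :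
    j = quad (j ord0) (j (@Ordinal 4 1 isT)) (j (@Ordinal 4 2 isT)) (j (@Ordinal 4 3 isT)).
  by apply/ffunP => a; rewrite ffunE; case: a => [[|[|[|[|]]]]] // lt; congr (j _); apply: val_inj.
have sumE i j k l (x : multi 4 0) :
    \sum_j' tpow v (quad i j k l) j' * scal (Tmap (b4 C) j' x)
    = \sum_m v i m * v j m * v k m * v l m.
  rewrite sum_constant => [|y /negPf y0]; last by rewrite Tmap_b4 y0 scal0 mulr0.
  by apply: eq_bigr => m _; rewrite tpow_quad Tmap_b4 constant_quad !eqxx scal1 mulr1.
split=> [/Mor_vector vb i j k l|vq].
  by rewrite -(sumE i j k l [ffun=> i]) vb Tmap_b4 constant_quad scal_nat.
apply/Mor_vector => j x; rewrite [j]quadE sumE vq Tmap_b4 constant_quad scal_nat.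
by [].
Qed.

(** The adjoint of the block partition, as an intertwiner, gives the relations
    of the transposed matrix; this is how the rows are reached. *)
Lemma cubic_tr_quartic (A : starAlgType C) (v : 'M[A]_4) : cubic v -> quartic v^T.
Proof.
move=> [sa vvT vTv vb] i j k l.
have /MorP/(_ [ffun=> i] (quad i j k l)) := Mor_adjoint sa vvT vTv vb.
rewrite (sum_multi0 _ [ffun=> i]) tpow0 mul1r Tmap_b4 constant_quad rmorph_nat scal_nat => <-.
rewrite sum_constant => [|y /negPf y0]; last by rewrite Tmap_b4 y0 rmorph0 scal0 mul0r.
apply: eq_bigr => m _; rewrite tpow_quad Tmap_b4 constant_quad !eqxx conjC1 scal1 mul1r.
by rewrite !mxE.
Qed.

(** Multiplying the quartic relation by [v l a] on the right and summing over
    [l] collapses the sum over [m] by orthogonality of the columns. *)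
Lemma quartic_cubic (A : starAlgType C) (v : 'M[A]_4) :
  quartic v -> v^T *m v = 1%:M -> forall i j k a,
  v i a * v j a * v k a = ((j == i) && (k == i))%:R * v i a.
Proof.
move=> vq vTv i j k a.
transitivity (\sum_l (\sum_m v i m * v j m * v k m * v l m) * v l a); last first.
  rewrite (bigD1 i) //= vq eqxx andbT big1 ?addr0 // => l li.
  by rewrite vq (negPf li) !andbF mul0r.
transitivity (\sum_m v i m * v j m * v k m * (m == a)%:R).
  by rewrite (bigD1 a) //= eqxx mulr1 big1 ?addr0 // => m /negPf->; rewrite mulr0.
under [RHS]eq_bigr => l _ do rewrite mulr_suml.
rewrite exchange_big; apply: eq_bigr => m _.
rewrite -(col_orthonormal vTv) mulr_sumr; apply: eq_bigr => l _.
by rewrite !mulrA.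
Qed.

(** The same device once more: insert [1 = \sum_k v k a * v k a]. *)
Lemma quartic_col0 (A : starAlgType C) (v : 'M[A]_4) :
  quartic v -> v^T *m v = 1%:M -> forall i j a, j != i -> v i a * v j a = 0.
Proof.
move=> vq vTv i j a ji; rewrite -[LHS]mulr1.
have <- : \sum_k v k a * v k a = 1 by rewrite (col_orthonormal vTv) eqxx.
rewrite mulr_sumr big1 // => k _.
by rewrite mulrA (quartic_cubic vq vTv) (negPf ji) !mul0r.
Qed.

Section Relations.
Variables (A : starAlgType C) (v : 'M[A]_4).
Hypothesis vc : cubic v.

Lemma cubic_col0 i j a : j != i -> v i a * v j a = 0.
Proof. exact: quartic_col0 (proj1 (Mor_b4_quartic v) (cubic_b4 vc)) (cubic_vTv vc) i j a. Qed.

Lemma cubic_row0 i j a : j != i -> v a i * v a j = 0.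
Proof.
move=> ji; have := @quartic_col0 _ v^T (cubic_tr_quartic vc); rewrite trmxK.
by move/(_ (cubic_vvT vc) i j a ji); rewrite !mxE.
Qed.

Lemma cubic_cube i a : v i a * v i a * v i a = v i a.
Proof.
rewrite (quartic_cubic (proj1 (Mor_b4_quartic v) (cubic_b4 vc)) (cubic_vTv vc)).
by rewrite eqxx mul1r.
Qed.
End Relations.
End CubicMatrices.

(** * The vector of the reflected one-block partition *)

Section ReflectedVector.
Variable C : numClosedFieldType.

Lemma Tmap_tau4 (j i : multi 4 1) :
  Tmap (tau4 C) j i = (j ord0 == i ord0)%:R - 2^-1.
Proof.
apply: (etrans (TmapB _ _ _ _ _)); congr (_ - _); first exact: Tmap_id.
by apply: (etrans _ (mulr1 _)); congr (_ * _); apply: Tmap_singletons.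
Qed.

(** The coefficients of [\sum_m (tau e_m)^4]. *)
Definition T4b4_coef (j : multi 4 4) : C := \sum_m \prod_a ((j a == m)%:R - 2^-1).

Lemma Tmap_tau4_tensor (j i : multi 4 (1 + 1 + 1 + 1)) :
  Tmap (lin_tensor (lin_tensor (lin_tensor (tau4 C) (tau4 C)) (tau4 C)) (tau4 C)) j i
  = \prod_(a < 4) (((j : multi 4 4) a == (i : multi 4 4) a)%:R - 2^-1).
Proof.
rewrite !Tmap_tensor !Tmap_tau4 !big_ord_recr big_ord0 /= mul1r !ffunE.
by congr (_ * _ * _ * _); congr ((j _ == i _)%:R - _); apply: val_inj.
Qed.

Lemma Tmap_T4b4 (j : multi 4 4) (i : multi 4 0) : Tmap (T4b4 C) j i = T4b4_coef j.
Proof.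
rewrite /T4b4 Tmap_comp sum_constant => [|x /negPf x0]; last first.
  by rewrite Tmap_b4 x0 mulr0.
apply: eq_bigr => m _; rewrite Tmap_b4 constant_quad !eqxx mulr1.
rewrite (Tmap_tau4_tensor j (quad m m m m)); apply: eq_bigr => a _.
by rewrite ffunE; case: a => [[|[|[|[|]]]]].
Qed.

Lemma T4b4_coef_perm (s : 'S_4) (j : multi 4 4) : T4b4_coef [ffun a => s (j a)] = T4b4_coef j.
Proof.
rewrite /T4b4_coef (reindex_inj (@perm_inj _ s)); apply: eq_bigr => m _.
by apply: eq_bigr => a _; rewrite ffunE (inj_eq perm_inj).
Qed.

Lemma prod_sign (I : finType) (b : I -> bool) :
  \prod_i (-1) ^+ b i = (-1) ^+ (\big[addb/false]_i b i) :> C.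
Proof. by rewrite (big_morph (fun b : bool => (-1) ^+ b : C) (signr_addb C) (erefl _)). Qed.

Definition odd_mult (j : multi 4 4) (m : 'I_4) : bool := \big[addb/false]_a (j a == m).

(** The entries of [tau] are 1/2 on the diagonal and -1/2 elsewhere, hence signs
    up to the factor -1/2, which occurs four times. *)
Lemma T4b4_coef_sign (j : multi 4 4) :
  T4b4_coef j = (2 ^- 4) * \sum_m (-1) ^+ odd_mult j m.
Proof.
rewrite /T4b4_coef mulr_sumr; apply: eq_bigr => m _; rewrite -prod_sign.
transitivity (\prod_a ((- 2^-1) * (-1) ^+ (j a == m) : C)).
  apply: eq_bigr => a _; case: (j a == m); rewrite ?mulr1 ?sub0r //.
  by rewrite mulrN1 opprK [X in X - _](splitr 1) mul1r addrK.
by rewrite big_split prodr_const card_ord exprNn -signr_odd expr0 mul1r exprVn.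
Qed.

(** Every value is taken once, all four summands equal -1, and nothing cancels. *)
Lemma T4b4_coef_id_neq0 : T4b4_coef [ffun a => a] != 0.
Proof.
rewrite T4b4_coef_sign; have oddE m : odd_mult [ffun a => a] m = true.
  rewrite /odd_mult (bigD1 m) //= ffunE eqxx big1 // => a /negPf am.
  by rewrite ffunE am.
under eq_bigr => m _ do rewrite oddE expr1.
rewrite sumr_const card_ord mulNrn mulrN oppr_eq0 mulf_neq0 ?pnatr_eq0 //.
by rewrite invr_eq0 expf_neq0 // pnatr_eq0.
Qed.

Lemma addb_odd_mult (e : 'I_4 -> bool) (j : multi 4 4) :
  \big[addb/false]_a e (j a) = \big[addb/false]_m (e m && odd_mult j m).
Proof.
transitivity (\big[addb/false]_m \big[addb/false]_a (e m && (j a == m))).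
  rewrite exchange_big; apply: eq_bigr => a _.
  by rewrite (bigD1 (j a)) //= eqxx andbT big1 ?addbF // => m; rewrite eq_sym => /negPf->;
    rewrite andbF.
by apply: eq_bigr => m _; rewrite -big_distrr.
Qed.

(** The number of values of odd multiplicity is 0, 2 or 4. If it is 0 or 4 the
    sign of [j] is 1, respectively the product of all signs; if it is 2, the
    coefficient vanishes. *)
Lemma T4b4_coef_even (e : 'I_4 -> bool) (j : multi 4 4) :
  \prod_i (-1) ^+ e i = 1 :> C -> (\prod_a (-1) ^+ e (j a)) * T4b4_coef j = T4b4_coef j.
Proof.
rewrite !prod_sign T4b4_coef_sign addb_odd_mult => e1.
have {e1} : \big[addb/false]_i e i = false.
  case: (\big[_/_]_i _) e1 => // /eqP; rewrite eq_sym -subr_eq0 opprK.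
  by rewrite -[1 + 1]/(2%:R) pnatr_eq0.
have : \big[addb/false]_m odd_mult j m = false.
  have := addb_odd_mult xpredT j; rewrite /= => <-.
  by rewrite big_const card_ord.
rewrite !big_ord_recl !big_ord0 /=.
(* What remains is a statement on eight booleans. *)
do 4![case: (odd_mult _ _) => /=]; do 4![case: (e _) => //=];
  by rewrite ?mul1r ?expr0 ?expr1 ?addr0 ?addNKr ?addKr ?subrr ?addNr ?mulr0.
Qed.
End ReflectedVector.

(** * Signed permutation matrices *)

Section SignedPermutations.
Variable C : numClosedFieldType.
Implicit Types (s : 'S_4) (e : {ffun 'I_4 -> bool}).

Lemma signed_perm_tr n (s : 'S_n) (e : {ffun 'I_n -> bool}) :
  (signed_perm_mx C s e)^T = signed_perm_mx C s^-1 [ffun i => e ((s^-1)%g i)].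
Proof.
apply/matrixP => i j; rewrite !mxE ffunE (canF_eq (permK s)) eq_sym.
by case: eqP => // ->.
Qed.

Lemma signed_perm_orth n (s : 'S_n) (e : {ffun 'I_n -> bool}) :
  signed_perm_mx C s e *m (signed_perm_mx C s e)^T = 1%:M.
Proof.
rewrite signed_perm_tr signed_perm_mul mulgV; apply/matrixP => i j.
by rewrite !mxE !ffunE permK addbb perm1.
Qed.

Lemma tpow_signed_perm s e (j : multi 4 4) (T : multi 4 4 -> C) :
  \sum_j' tpow (signed_perm_mx C s e : 'M[C^o]_4) j j' * T j'
  = (\prod_a (-1) ^+ e (j a)) * T [ffun a => s (j a)] :> C^o.
Proof.
rewrite (bigD1 [ffun a => s (j a)]) //= [X in _ + X]big1 ?addr0 => [|j' j's].
  congr (_ * _); apply: eq_bigr => a _.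
  by rewrite mxE ffunE eqxx mulr1n.
have [a ja] : exists a, s (j a) != j' a.
  apply/existsP; apply: contraR j's; rewrite negb_exists => /forallP sj.
  by apply/eqP/ffunP => a; apply/esym/eqP; rewrite ffunE; have := sj a; rewrite negbK.
by rewrite /tpow (bigD1 a) //= mxE (negPf ja) mulr0n !mul0r.
Qed.

Lemma signed_perm_cubic s e : cubic (signed_perm_mx C s e : 'M[C^o]_4).
Proof.
have gg := signed_perm_orth s e.
split=> [i j|||]; [|exact: gg|exact: mulmx1C gg|].
- rewrite -[LHS]/((signed_perm_mx C s e i j)^*) mxE.
  by rewrite rmorphMn rmorphXn rmorphN rmorph1.
- apply/Mor_vector => j i.
  apply: (etrans (tpow_signed_perm _ _ _ (fun j' => Tmap (b4 C) j' i))).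
  rewrite -[scal _]/(Tmap (b4 C) j i) !Tmap_b4.
  have -> : [forall a, [ffun a => s (j a)] a == [ffun a => s (j a)] ord0]
      = [forall a, j a == j ord0].
    by apply: eq_forallb => a; rewrite !ffunE (inj_eq perm_inj).
  case: forallP => [jE|_]; last by rewrite mulr0.
  rewrite mulr1 (eq_bigr (fun=> (-1) ^+ e (j ord0))) => [|a _]; last by rewrite (eqP (jE a)).
  by rewrite prodr_const card_ord -exprM mulnC exprM -signr_odd expr1n.
Qed.

(** The coefficients being invariant under [s], only the signs act. Testing at
    the identity labelling, where the coefficient is nonzero, gives the product of
    all signs. *)
Lemma signed_perm_T4b4 s e :
  Mor (signed_perm_mx C s e : 'M[C^o]_4) (Tmap (T4b4 C)) <-> \prod_i (-1) ^+ e i = 1 :> C.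
Proof.
rewrite Mor_vector; split=> [/(_ [ffun a => a] [ffun=> ord0])|e1 j i].
  move/(etrans (esym (tpow_signed_perm _ _ _ (fun j' => Tmap (T4b4 C) j' [ffun=> ord0])))).
  rewrite -[scal _]/(Tmap (T4b4 C) [ffun a => a] [ffun=> ord0]) !Tmap_T4b4 T4b4_coef_perm.
  rewrite -[RHS]mul1r => /(mulIf (T4b4_coef_id_neq0 C)) e1; rewrite -[RHS]e1.
    by apply: eq_bigr => a _; rewrite ffunE.
apply: (etrans (tpow_signed_perm _ _ _ (fun j' => Tmap (T4b4 C) j' i))).
rewrite -[scal _]/(Tmap (T4b4 C) j i) !Tmap_T4b4 T4b4_coef_perm.
exact: T4b4_coef_even.
Qed.

Section Evaluation.
Variables (N : nat) (G : set 'M[C]_N).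

Lemma evaluation (g : set_type G) :
  exists ev : {starhom Defs.coord (matrix_group G) -> C^o}, forall x, ev x = val x g.
Proof.
pose ev (x : Defs.coord (matrix_group G)) : C^o := val x g.
have hN : nmod_morphism ev by [].
have hM : monoid_morphism ev by [].
have hZ a : ev (scal a) = scal a by [].
have hS x : ev (star x) = star (ev x) by [].
pose h1 := GRing.isNmodMorphism.Build _ C^o ev hN.
pose h2 := GRing.isMonoidMorphism.Build _ C^o ev hM.
pose h3 := isStarPreserving.Build C _ C^o ev hZ hS.
pose h : {starhom Defs.coord (matrix_group G) -> C^o} := HB.pack ev h1 h2 h3.
by exists h.
Qed.

Lemma separating_evaluations :
  exists ev : set_type G -> {starhom Defs.coord (matrix_group G) -> C^o},
    (forall g, map_mx (ev g) (fund (matrix_group G)) = val g)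
    /\ (forall x, (forall g, ev g x = 0) -> x = 0).
Proof.
have [ev evE] := choice evaluation; exists ev; split=> [g|x x0].
  by apply/matrixP => i j; rewrite mxE evE mxE.
by apply/val_inj/funext => g; rewrite -evE x0.
Qed.
End Evaluation.

Lemma D4_cubic : cubic (fund (D4 C)).
Proof.
have [ev [evu ev0]] := separating_evaluations (@D4_set C).
apply: (separated_cubic ev0) => g; rewrite evu.
by have [[s [e ->]] _] := set_mem (valP g); apply: signed_perm_cubic.
Qed.

Lemma D4_T4b4 : Mor (fund (D4 C)) (Tmap (T4b4 C)).
Proof.
have [ev [evu ev0]] := separating_evaluations (@D4_set C).
apply: (separated_Mor ev0) => g; rewrite evu.
have [[s [e ->]]] := set_mem (valP g); rewrite permanent_signed => e1.
exact/signed_perm_T4b4.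
Qed.
End SignedPermutations.

(** * Magic unitaries *)

Section MagicUnitaries.
Variable C : numClosedFieldType.

Record magic (A : starAlgType C) (v : 'M[A]_4) : Prop := {
  magic_sa : forall i j, star (v i j) = v i j;
  magic_row : forall i, \sum_j v i j = 1;
  magic_col : forall j, \sum_i v i j = 1;
  magic_row_mul : forall i j k, v i j * v i k = (j == k)%:R * v i j;
  magic_col_mul : forall i j k, v i k * v j k = (i == j)%:R * v i k
}.

Lemma magic_cubic (A : starAlgType C) (v : 'M[A]_4) : magic v -> cubic v.
Proof.
move=> [sa row col rowM colM]; split=> [//|||].
- apply/matrixP => i j; rewrite !mxE.
  under eq_bigr => k _ do rewrite mxE colM.
  by rewrite -mulr_sumr row mulr1.
- apply/matrixP => i j; rewrite !mxE.
  under eq_bigr => k _ do rewrite mxE rowM.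
  by rewrite -mulr_sumr col mulr1.
- apply/Mor_b4_quartic => i j k l.
  transitivity (\sum_m ([&& j == i, k == i & l == i])%:R * v i m).
    apply: eq_bigr => m _; rewrite colM eq_sym; case: (j == i); rewrite ?mul0r ?mul1r //.
    rewrite colM eq_sym; case: (k == i); rewrite ?mul0r ?mul1r //.
    by rewrite colM eq_sym.
  by rewrite -mulr_sumr row mulr1.
Qed.

(** The rows and columns of a magic unitary sum to 1, which says that it commutes
    with the all-ones matrix, hence with [tau]. *)
Lemma magic_T4b4 (A : starAlgType C) (v : 'M[A]_4) : magic v -> Mor v (Tmap (T4b4 C)).
Proof.
move=> vm; have [sa vvT vTv vb] := magic_cubic vm.
have KP := Mor_category sa vvT vTv.
have v_all : Mor v (Tmap (pbasis C (singletons 1 1))).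
  apply/MorP => j i; rewrite !sum_multi1.
  under eq_bigr => a _ do rewrite Tmap_singletons scal1 mul1r tpow1 ffunE.
  under [RHS]eq_bigr => a _ do rewrite Tmap_singletons scal1 mulr1 tpow1 ffunE.
  by rewrite (magic_row vm) (magic_col vm).
have v_tau : Mor v (Tmap (tau4 C)).
  have := lincatP KP (- 2^-1) v_all (lincat_id KP).
  by rewrite scaleNr addrC.
have v_tau2 := lincat_tensor KP v_tau v_tau.
have v_tau4 := lincat_tensor KP (lincat_tensor KP v_tau2 v_tau) v_tau.
exact: (lincat_comp KP v_tau4 vb).
Qed.

(** Block diagonal with blocks [p, 1 - p; 1 - p, p] and [q, 1 - q; 1 - q, q]. *)
Definition two_projections (A : starAlgType C) (p q : A) : 'M[A]_4 :=
  \matrix_(i, j) let r := if (i < 2)%N then p else q in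
    if (i < 2)%N == (j < 2)%N then if i == j then r else 1 - r else 0.

Lemma two_projections_magic (A : starAlgType C) (p q : A) :
  star p = p -> star q = q -> p * p = p -> q * q = q -> magic (two_projections p q).
Proof.
move=> sp sq pp qq.
have compl (r : A) : r * r = r ->
    [/\ r * (1 - r) = 0, (1 - r) * r = 0 & (1 - r) * (1 - r) = 1 - r].
  by move=> rr; rewrite !(mulrBr, mulrBl) !mulr1 !mul1r rr subrr subr0.
have [p1 p2 p3] := compl p pp; have [q1 q2 q3] := compl q qq.
split=> [i j|i|j|i j k|i j k].
- rewrite mxE; case: (i < 2)%N; case: (j < 2)%N; case: (i == j) => /=;
  by rewrite ?starD ?starN ?star1 ?star0 ?sp ?sq.
- rewrite !big_ord_recl big_ord0 !mxE; case: i => [[|[|[|[|]]]]] //= _;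
  by rewrite ?addr0 ?add0r ?subrK // addrC subrK.
- rewrite !big_ord_recl big_ord0 !mxE; case: j => [[|[|[|[|]]]]] //= _;
  by rewrite ?addr0 ?add0r ?subrK // addrC subrK.
- rewrite !mxE; case: i => [[|[|[|[|]]]]] // ?; case: j => [[|[|[|[|]]]]] // ?;
  case: k => [[|[|[|[|]]]]] // ?; rewrite -?(inj_eq val_inj) /= ?mul1r ?mul0r ?mulr0 //.
rewrite !mxE; case: i => [[|[|[|[|]]]]] // ?; case: j => [[|[|[|[|]]]]] // ?;
case: k => [[|[|[|[|]]]]] // ?; rewrite -?(inj_eq val_inj) /= ?mul1r ?mul0r ?mulr0 //.
Qed.
End MagicUnitaries.

(** Complex matrices with the conjugate transpose: a noncommutative star-algebra
    to hold two projections in general position. *)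
Section MatrixAlgebra.
Variables (C : numClosedFieldType) (n : nat).
Let mstar (x : 'M[C]_n) : 'M[C]_n := map_mx Num.conj x^T.
Let mscalD a b : (a + b)%:M = a%:M + b%:M :> 'M[C]_n. Proof. exact: raddfD. Qed.
Let mscalM a b : (a * b)%:M = a%:M * b%:M :> 'M[C]_n. Proof. exact: scalar_mxM. Qed.
Let mscalC (a : C) (x : 'M[C]_n) : a%:M * x = x * a%:M.
Proof. by rewrite -[LHS]/(a%:M *m x) -[RHS]/(x *m a%:M) scalar_mxC. Qed.
Let mstarK : involutive mstar.
Proof. by move=> x; apply/matrixP => i j; rewrite !mxE conjCK. Qed.
Let mstarD x y : mstar (x + y) = mstar x + mstar y.
Proof. by apply/matrixP => i j; rewrite !mxE rmorphD. Qed.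
Let mstarM (x y : 'M[C]_n) : mstar (x * y) = mstar y * mstar x.
Proof. by rewrite /mstar -[x * y]/(x *m y) trmx_mul map_mxM. Qed.
Let mstar_scal a : mstar a%:M = (a^*)%:M.
Proof. by rewrite /mstar tr_scalar_mx map_scalar_mx. Qed.
HB.instance Definition _ := isStarAlgebra.Build C 'M[C]_n
  (erefl _ : scalar_mx 1 = 1) mscalD mscalM mscalC mstarK mstarD mstarM mstar_scal.
End MatrixAlgebra.

Lemma noncommuting_projections (C : numClosedFieldType) :
  exists p q : 'M[C]_2, [/\ star p = p, star q = q, p * p = p, q * q = q & p * q != q * p].
Proof.
pose p : 'M[C]_2 := \matrix_(i, j) ((i == ord0) && (j == ord0))%:R.
pose q : 'M[C]_2 := const_mx 2^-1.
have half : 2^-1 * 2^-1 + 2^-1 * 2^-1 = 2^-1 :> C.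
  by rewrite -mulrDl -{1 2}[2^-1]mul1r -splitr mul1r.
have qq : q * q = q.
  by apply/matrixP => i j; rewrite [LHS]mxE !big_ord_recl big_ord0 !mxE addr0.
exists p, q; split=> //.
- by apply/matrixP => i j; rewrite !mxE rmorph_nat andbC.
- by apply/matrixP => i j; rewrite !mxE fmorphV rmorph_nat.
- apply/matrixP => i j; rewrite [LHS]mxE !big_ord_recl big_ord0 !mxE /=.
  by rewrite andbF mul0r !addr0 -natrM mulnb andbT.
apply/eqP => /matrixP/(_ ord0 ord_max)/eqP.
rewrite ![_ ord0 _]mxE !big_ord_recl !big_ord0 !mxE /= mul1r mul0r !mulr0 !addr0.
by rewrite invr_eq0 pnatr_eq0.
Qed.

(** * Commuting entries *)

Section CommutingCase.
Variable C : numClosedFieldType.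

Lemma scal_mul_eq0 (A : starAlgType C) (a : C) (x : A) : a != 0 -> scal a * x = 0 -> x = 0.
Proof.
move=> a0 ax; rewrite -[x]mul1r -scal1 -(mulVf a0) scalM -mulrA ax.
exact: mulr0.
Qed.

Lemma eigen_prod (A : starAlgType C) I (r : seq I) (F : I -> A) (c : I -> C) (x : A) :
  (forall i, F i * x = scal (c i) * x) ->
  (\prod_(i <- r) F i) * x = scal (\prod_(i <- r) c i) * x.
Proof.
move=> Fx; elim: r => [|i r IHr]; first by rewrite !big_nil scal1.
by rewrite !big_cons -mulrA IHr mulrA -scalC -mulrA Fx mulrA -scalM mulrC.
Qed.

Lemma scalCA (A : starAlgType C) (a : C) (x y : A) : x * (scal a * y) = scal a * (x * y).
Proof. by rewrite !mulrA scalC. Qed.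

Section PointEvaluation.
Variables (N : nat) (G : set 'M[C]_N) (A : starAlgType C) (W : finType).
Variables (e : W -> A) (pt : W -> 'M[C]_N).
Hypothesis e_sum : \sum_w e w = 1.
Hypothesis e_mul : forall w w', e w * e w' = (w == w')%:R * e w.
Hypothesis e_star : forall w, star (e w) = e w.
Hypothesis e_pt : forall w, e w != 0 -> G (pt w).

(** Evaluation at the points [pt w], weighted by the partition of unity [e]. A
    point outside [G] has weight zero, so that its junk value is harmless. *)
Lemma hom_of_point_idempotents : exists h : {starhom Defs.coord (matrix_group G) -> A},
  forall i j, h (fund (matrix_group G) i j) = \sum_w scal (pt w i j) * e w.
Proof.
pose O := Defs.coord (matrix_group G).
pose at_ w (x : O) : C := if insub (pt w) is Some g then val x g else 0.
have atP w : e w = 0 \/ exists2 g : set_type G, val g = pt w & forall x, at_ w x = val x g.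
  have [->|/e_pt Gw] := eqVneq (e w) 0; [by left|right].
  by rewrite /at_; case: insubP => [g _ gE|/negP[]]; [exists g|apply: mem_set].
pose h (x : O) : A := \sum_w scal (at_ w x) * e w.
have hD x y : h (x + y) = h x + h y.
  rewrite -big_split; apply: eq_bigr => w _ /=; rewrite -mulrDl -scalD.
  by case: (atP w) => [->|[g _ gE]]; rewrite ?mulr0 // !gE.
have hZ a : h (scal a) = scal a.
  rewrite -[RHS]mulr1 -e_sum mulr_sumr; apply: eq_bigr => w _.
  by case: (atP w) => [->|[g _ gE]]; rewrite ?mulr0 // !gE.
have hM x y : h (x * y) = h x * h y.
  rewrite mulr_suml; apply: eq_bigr => w _; rewrite mulr_sumr (bigD1 w) //=.
  have mulE w' : scal (at_ w x) * e w * (scal (at_ w' y) * e w')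
      = (w == w')%:R * (scal (at_ w x * at_ w' y) * e w).
    rewrite scalM -!mulrA (mulrA (e w)) -scalC -mulrA e_mul !mulrA.
    by case: (w == w'); rewrite ?mulr1 ?mul1r // !(mulr0, mul0r).
  rewrite big1 ?addr0 => [|w']; last by rewrite eq_sym mulE => /negPf->; rewrite mul0r.
  rewrite mulE eqxx mul1r.
  by case: (atP w) => [->|[g _ gE]]; rewrite ?mulr0 // !gE.
have hS x : h (star x) = star (h x).
  rewrite star_sum; apply: eq_bigr => w _; rewrite starM e_star star_scal -scalC.
  by case: (atP w) => [->|[g _ gE]]; rewrite ?mulr0 // !gE.
have h_nmod : nmod_morphism h by split=> //; rewrite -scal0 hZ scal0.
have h_mon : monoid_morphism h by split=> //; rewrite -scal1 hZ scal1.
pose h1 := GRing.isNmodMorphism.Build O A h h_nmod.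
pose h2 := GRing.isMonoidMorphism.Build O A h h_mon.
pose h3 := isStarPreserving.Build C O A h hZ hS.
pose hh : {starhom O -> A} := HB.pack h h1 h2 h3.
exists hh => i j; apply: eq_bigr => w _.
by case: (atP w) => [->|[g <- gE]]; rewrite ?mulr0 // gE mxE.
Qed.
End PointEvaluation.

Section ProductPartition.
Variables (R : comPzRingType) (I K : finType) (p : I -> K -> R).
Hypothesis p_sum : forall i, \sum_c p i c = 1.
Hypothesis p_mul : forall i c c', p i c * p i c' = (c == c')%:R * p i c'.
Definition prod_idem (w : {ffun I -> K}) : R := \prod_i p i (w i).

Lemma prod_idem_sum : \sum_w prod_idem w = 1.
Proof. by rewrite -bigA_distr_bigA big1. Qed.

Lemma prod_idem_absorb i c w : p i c * prod_idem w = (c == w i)%:R * prod_idem w.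
Proof. by rewrite /prod_idem (bigD1 i) //= !mulrA p_mul. Qed.

Lemma prod_idem_mul w w' : prod_idem w * prod_idem w' = (w == w')%:R * prod_idem w.
Proof.
have [<-|ww'] := eqVneq w w'.
  rewrite mul1r -big_split; apply: eq_bigr => i _ /=.
  by rewrite p_mul eqxx mul1r.
have [i wi] : exists i, w i != w' i.
  apply/existsP; apply: contraR ww'; rewrite negb_exists => /forallP ww'.
  by apply/eqP/ffunP => i; apply/eqP; have := ww' i; rewrite negbK.
rewrite mul0r {1}/prod_idem (bigD1 i) //= mulrAC prod_idem_absorb (negPf wi).
by rewrite !mul0r.
Qed.
End ProductPartition.

(** In a commutative algebra, the products of one member from each of several
    partitions of unity form their common refinement. *)
Lemma commuting_partitions (A : starAlgType C) (I K : finType) (p : I -> K -> A) :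
  (forall x y : A, x * y = y * x) ->
  (forall i, \sum_c p i c = 1) ->
  (forall i c c', p i c * p i c' = (c == c')%:R * p i c') ->
  (forall i c, star (p i c) = p i c) ->
  exists e : {ffun I -> K} -> A,
    [/\ \sum_w e w = 1,
        forall w w', e w * e w' = (w == w')%:R * e w,
        forall w, star (e w) = e w
      & forall i c w, p i c * e w = (c == w i)%:R * e w].
Proof.
move=> comm p_sum p_mul p_star.
pose R : comPzRingType := HB.pack (StarAlgebra.sort A)
  (GRing.PzRing_hasCommutativeMul.Build A comm).
exists (@prod_idem R I K p); split.
- exact: (@prod_idem_sum R).
- exact: (@prod_idem_mul R).
- move=> w; rewrite /prod_idem; elim/big_rec: _ => [|i x _ xE]; first exact: star1.
  by rewrite -[_ * _]/(@GRing.mul A _ _) starM xE p_star comm.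
- exact: (@prod_idem_absorb R).
Qed.

(** [D4] is the spectrum of the commutative algebra presented by the relations of
    [D4plus]. *)
Lemma commuting_D4 (A : starAlgType C) (v : 'M[A]_4) :
  cubic v -> Mor v (Tmap (T4b4 C)) -> (forall x y : A, x * y = y * x) ->
  exists h : {starhom Defs.coord (D4 C) -> A}, forall i j, h (fund (D4 C) i j) = v i j.
Proof.
move=> vc vT comm.
have [p pE] : exists p : 'I_4 -> 'I_4 * bool -> A, forall i c,
    p i c = scal 2^-1 * (v i c.1 * v i c.1 + scal ((-1) ^+ c.2) * v i c.1).
  by eexists.
pose lam (c : 'I_4 * bool) (b : 'I_4) : C := (-1) ^+ c.2 *+ (c.1 == b).
(* As [v i a] squares to a projection, [p i (a, s)] is its spectral projection
   for the eigenvalue [(-1) ^+ s], and [lam (a, s)] lists the eigenvalues of the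
   row [i] there. *)
have vp i b c : v i b * p i c = scal (lam c b) * p i c.
  rewrite pE /lam scalCA mulrDr scalCA mulrA.
  have [<-|cb] := eqVneq c.1 b; last first.
    by rewrite (cubic_row0 vc) // mulr0n scal0 !(mul0r, mulr0, addr0).
  rewrite mulr1n cubic_cube // scalCA; congr (_ * _).
  by rewrite mulrDr addrC; congr (_ + _); rewrite mulrA -scalM -signr_addb addbb scal1 mul1r.
have p_sum i : \sum_c p i c = 1.
  have -> : 1 = (i == i)%:R :> A by rewrite eqxx.
  rewrite -(row_orthonormal (cubic_vvT vc)).
  transitivity (\sum_a \sum_b p i (a, b)).
    by rewrite pair_bigA; apply: eq_bigr => -[].
  apply: eq_bigr => a _.
  rewrite big_bool !pE /= -mulrDr addrACA expr0 expr1 scalN1 scal1 mul1r addNr addr0.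
  by rewrite mulrDr -mulrDl -scalD -[2^-1]mul1r -splitr scal1 mul1r.
have p_mul i c c' : p i c * p i c' = (c == c')%:R * p i c'.
  transitivity (scal (2^-1 * (lam c' c.1 * lam c' c.1 + (-1) ^+ c.2 * lam c' c.1)) * p i c').
    rewrite [p i c]pE -mulrA mulrDl -!mulrA vp scalCA vp !mulrA -!scalM -mulrDl -scalD.
    by rewrite mulrA -scalM.
  rewrite -scal_nat; congr (scal _ * _); rewrite /lam.
  case: c c' => [a s] [a' s']; rewrite /= -pair_eqE /= eq_sym.
  case: (a == a') => /=; last by rewrite mulr0n !mulr0 addr0 mulr0.
  have half : 2^-1 * (1 + 1) = 1 :> C by rewrite mulVf // pnatr_eq0.
  by case: s; case: s';
    rewrite /= ?mulr1n ?expr0 ?expr1 ?mulrNN ?mulr1 ?mul1r ?addrN ?mulr0 ?half.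
have p_star i c : star (p i c) = p i c.
  rewrite pE starM star_scal fmorphV rmorph_nat -scalC starD !starM star_scal.
  by rewrite rmorph_sign -scalC !(cubic_sa vc).
have [e [e_sum e_mul e_star e_abs]] := commuting_partitions comm p_sum p_mul p_star.
pose pt (w : {ffun 'I_4 -> 'I_4 * bool}) : 'M[C]_4 := \matrix_(i, j) lam (w i) j.
(* On the range of [e w] the matrix [v] acts as the complex matrix [pt w]. *)
have ve i j w : v i j * e w = scal (pt w i j) * e w.
  have pe : e w = p i (w i) * e w by rewrite e_abs eqxx mul1r.
  by rewrite pe mulrA vp -mulrA mxE.
have e_pt w : e w != 0 -> D4_set (pt w).
  move=> e0.
  (* A repeated column would make a product of two entries of one column, which
     vanishes, act on [e w] by a nonzero sign. *)
  have inj : injective (fun i => (w i).1).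
    move=> i j /= wij; apply: contraNeq e0 => ij; apply/eqP.
    have : v i (w i).1 * (v j (w i).1 * e w) = 0.
      by rewrite mulrA (cubic_col0 vc) ?mul0r // eq_sym.
    rewrite ve scalCA ve mulrA -scalM; apply: scal_mul_eq0.
    by rewrite !mxE /lam -wij eqxx mulr1n -signr_addb signr_eq0.
  have ptE : pt w = signed_perm_mx C (perm inj) [ffun i => (w i).2].
    by apply/matrixP => i j; rewrite !mxE permE ffunE.
  split; first by exists (perm inj), [ffun i => (w i).2].
  rewrite ptE permanent_signed; apply/eqP; rewrite -subr_eq0; apply: contraNT e0 => s1.
  have /Mor_vector/(_ [ffun a => a] [ffun=> ord0])/(congr1 (fun x => x * e w)) := vT.
  rewrite mulr_suml.
  (* On [e w], the reflected vector relation at the identity labelling reads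
     [sign * coef = coef], with a nonzero coefficient. *)
  have tE j' : tpow v [ffun a => a] j' * scal (T4b4_coef C j') * e w
      = scal (tpow (pt w : 'M[C^o]_4) [ffun a => a] j' * T4b4_coef C j') * e w.
    rewrite -mulrA scalCA mulrC scalM -mulrA.
    by congr (_ * _); apply: eigen_prod => a; apply: ve.
  under eq_bigr => j' _ do rewrite Tmap_T4b4 tE.
  rewrite -mulr_suml -scal_sum ptE tpow_signed_perm Tmap_T4b4 T4b4_coef_perm.
  move/eqP; rewrite -subr_eq0 -mulrBl -scalN1 -scalM -scalD.
  rewrite -mulrDl => /eqP/scal_mul_eq0 ew; apply/eqP/ew.
  rewrite mulf_neq0 ?T4b4_coef_id_neq0 //; apply: contraNneq s1 => <-; apply/eqP.
  by congr (_ - _); apply: eq_bigr => a _; rewrite [in RHS](ffunE (fun a : 'I_4 => a)).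
have [h hE] := hom_of_point_idempotents e_sum e_mul e_star e_pt.
exists h => i j; rewrite hE -[RHS]mulr1 -e_sum mulr_sumr.
by apply: eq_bigr => w _; rewrite ve.
Qed.
End CommutingCase.

(** * Comparison of the quantum groups *)

Section Comparison.
Variable C : numClosedFieldType.
Notation uD4p := (fund (D4plus C)).
Notation uD4 := (fund (D4 C)).

Lemma D4_commutative (x y : Defs.coord (D4 C)) : x * y = y * x.
Proof. by apply/val_inj; rewrite !rmorphM /=; apply: mulrC. Qed.

(** The centralizer of a star-closed set is a star-subalgebra: apply this to the
    entries, then to the whole algebra. *)
Lemma commutative_of_entries (A : starAlgType C) (v : 'M[A]_4) :
  generates (entries v) -> (forall i j, star (v i j) = v i j) ->
  (forall i j k l, v i j * v k l = v k l * v i j) -> forall x y : A, x * y = y * x.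
Proof.
move=> gen sa comm.
have centralizer (S : set A) : (forall s, S s -> S (star s)) ->
    star_subalgebra (fun x => forall s, S s -> x * s = s * x).
  move=> Sstar; split=> [a s _|x y xS yS s Ss|x y xS yS s Ss|x xS s Ss].
  - exact: scalC.
  - by rewrite mulrDl mulrDr xS // yS.
  - by rewrite -mulrA yS // mulrA xS // mulrA.
  - by rewrite -[s]starK -!starM xS //; apply: Sstar.
have all (P : A -> Prop) : star_subalgebra P -> (forall i j, P (v i j)) -> forall x, P x.
  move=> PP Pv x; have : star_span (entries v) x by rewrite gen.
  by apply=> // _ [i [j ->]].
have entry_central i j x : x * v i j = v i j * x.
  have := all _ (centralizer (entries v) _) _ x; apply; last by exists i, j.
    by move=> _ [k [l ->]]; exists k, l; rewrite sa.
  by move=> k l _ [k' [l' ->]].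
by move=> x y; have := all _ (centralizer setT _) _ x; apply.
Qed.

Lemma qsubgroup_of_hom (H G : matrix_pair C 4) (f : {starhom Defs.coord G -> Defs.coord H}) :
  generates (entries (fund H)) -> (forall i j, f (fund G i j) = fund H i j) -> qsubgroup H G.
Proof.
move=> gen fu; exists f => //; apply: (generates_surj (f := f) gen) => _ [i [j ->]].
by exists (fund G i j).
Qed.

Lemma generates_impose (G : matrix_pair C 4) (S : set (Defs.coord G)) :
  generates (entries (fund G)) -> generates (entries (fund (impose S))).
Proof.
move=> gen; apply/seteqP; split=> // q _ B BP uB.
have [x <-] := quo_surj q; have : star_span (entries (fund G)) x by rewrite gen.
move/(_ (fun x => B (quo_pi S x))); apply.
  split=> [a|y z By Bz|y z By Bz|y By].
  - by rewrite hom_scal; apply: (subalg_scal BP).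
  - by rewrite rmorphD; apply: (subalgD BP).
  - by rewrite rmorphM; apply: (subalgM BP).
  - by rewrite hom_star; apply: (subalg_star BP).
by move=> _ [i [j ->]]; apply: uB; exists i, j; rewrite mxE.
Qed.

Lemma cmqg_generates (G : cmqg C 4) : generates (entries (fund G)).
Proof. by have [] := cmqgP G. Qed.

Lemma D4_sub_D4plus :
  exists f : {starhom Defs.coord (D4plus C) -> Defs.coord (D4 C)},
    forall i j, f (uD4p i j) = uD4 i j.
Proof. exact: D4plus_universal (D4_cubic C) (D4_T4b4 C). Qed.

(** Relations which hold in [D4] and make the entries commute cut [D4plus] down
    to [D4]. *)
Lemma impose_identical_D4 (S : set (Defs.coord (D4plus C))) :
  (forall f : {starhom Defs.coord (D4plus C) -> Defs.coord (D4 C)},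
     map_mx f uD4p = uD4 -> forall x, S x -> f x = 0) ->
  (let v := fund (impose S) in forall i j k l, v i j * v k l = v k l * v i j) ->
  identical (impose S) (D4 C).
Proof.
move=> S0 comm; split; last first.
  have [f fu] := D4_sub_D4plus.
  have fS x : S x -> f x = 0 by apply: S0; apply/matrixP => i j; rewrite mxE fu.
  have [g gE] := quo_lift_hom fS.
  apply: (@qsubgroup_of_hom (D4 C) (impose S) g); first exact: cmqg_generates.
  by move=> i j; rewrite mxE gE fu.
have gen := @generates_impose (D4plus C) S (cmqg_generates _).
have vc : cubic (fund (impose S)) := hom_cubic (quo_pi S) (D4plus_cubic C).
have vT : Mor (fund (impose S)) _ := hom_Mor (quo_pi S) (@D4plus_T4b4 C).
have [h hu] := commuting_D4 vc vT (commutative_of_entries gen (cubic_sa vc) comm).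
exact: qsubgroup_of_hom hu.
Qed.

Lemma impose_fund (G : matrix_pair C 4) (S : set (Defs.coord G)) i j :
  fund (impose S) i j = quo_pi S (fund G i j).
Proof. by rewrite mxE. Qed.

Lemma quo_pi_rel (A : starAlgType C) (S : set A) x y : S (x - y) -> quo_pi S x = quo_pi S y.
Proof. by move=> Sxy; apply: subr0_eq; rewrite -rmorphB; apply: quo_pi_eq0. Qed.

Lemma impose_commutation : identical (impose (commutation_rels uD4p)) (D4 C).
Proof.
apply: impose_identical_D4 => [f _ _ [i [j [k [l ->]]]]|v i j k l].
  by apply/eqP; rewrite rmorphB !rmorphM subr_eq0; apply/eqP/D4_commutative.
by rewrite !impose_fund -!rmorphM; apply: quo_pi_rel; exists i, j, k, l.
Qed.

Lemma impose_anticommutation : identical (impose (anticommutation_rels uD4p)) (D4 C).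
Proof.
apply: impose_identical_D4 => [f fu x|v i j k l].
  have fE i j : f (uD4p i j) = uD4 i j by rewrite -fu [RHS]mxE.
  have c := D4_cubic C.
  case=> [i j k ij|i j k ij|i j k l _ _]; apply/eqP;
    rewrite rmorphB ?rmorphN !rmorphM subr_eq0 /= !fE; apply/eqP.
  - by rewrite !(cubic_col0 c) ?oppr0 // eq_sym.
  - by rewrite !(cubic_row0 c) ?oppr0 // eq_sym.
  - exact: D4_commutative.
have vc : cubic v := hom_cubic (quo_pi _) (D4plus_cubic C).
have [<-|ik] := eqVneq i k.
  have [<-//|jl] := eqVneq j l.
  by rewrite !(cubic_row0 vc) // eq_sym.
have [<-|jl] := eqVneq j l.
  by rewrite !(cubic_col0 vc) // eq_sym.
by rewrite !impose_fund -!rmorphM; apply/quo_pi_rel/anticomm_comm.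
Qed.

(** Were they identical, the entries of [D4plus] would commute, and so would the
    two projections of a magic unitary. *)
Lemma D4_proper : proper_qsubgroup (D4 C) (D4plus C).
Proof.
have [f fu] := D4_sub_D4plus; split.
  by apply: (qsubgroup_of_hom _ fu); apply: cmqg_generates.
move=> [_ [g _ gu]]; have [p [q [sp sq pp qq /eqP[]]]] := noncommuting_projections C.
have m := two_projections_magic sp sq pp qq.
have [h hu] := D4plus_universal (magic_cubic m) (magic_T4b4 m).
have vE i j : two_projections p q i j = h (g (uD4 i j)) by rewrite gu hu.
have -> : p = h (g (uD4 ord0 ord0)) by rewrite -vE mxE.
have -> : q = h (g (uD4 ord_max ord_max)) by rewrite -vE mxE.
by rewrite -!rmorphM /= D4_commutative.
Qed.

(** The diagonal matrix with entries -1, 1, 1, 1 satisfies the relations of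
    [H4plus] but moves the reflected vector. *)
Lemma D4plus_proper : proper_qsubgroup (D4plus C) (H4plus C).
Proof.
split.
  have [f fu] := H4plus_universal (D4plus_cubic C).
  by apply: (qsubgroup_of_hom _ fu); apply: cmqg_generates.
move=> [_ [g _ gu]].
pose e : {ffun 'I_4 -> bool} := [ffun i => i == ord0].
have [h hu] := H4plus_universal (signed_perm_cubic C 1%g e).
have gE : map_mx g uD4p = fund (H4plus C) by apply/matrixP => i j; rewrite mxE gu.
have hE : map_mx h (fund (H4plus C)) = signed_perm_mx C 1%g e.
  by apply/matrixP => i j; rewrite mxE hu.
have := hom_Mor h (hom_Mor g (@D4plus_T4b4 C)); rewrite gE hE => /signed_perm_T4b4/eqP.
rewrite (bigD1 ord0) //= ffunE eqxx big1 => [|i /negPf i0]; last by rewrite ffunE i0.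
by rewrite mulr1 expr1 eq_sym -subr_eq0 opprK -[1 + 1]/(2%:R) pnatr_eq0.
Qed.
End Comparison.

Theorem theoremA (R : realType) :
  [/\ proper_qsubgroup (D4 R[i]) (D4plus R[i]),
      proper_qsubgroup (D4plus R[i]) (H4plus R[i]),
      identical (impose (commutation_rels (fund (D4plus R[i])))) (D4 R[i])
    & identical (impose (anticommutation_rels (fund (D4plus R[i])))) (D4 R[i])].
Proof.
split; [exact: D4_proper|exact: D4plus_proper|exact: impose_commutation|].
exact: impose_anticommutation.
Qed.
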